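(* Let $n\ge 1$, let $1\le d\le n$, and let $\lambda$ be the $n$-partition $(d,\dots,d,d-1,\dots,2,1)$, i.e. $\lambda_i=\min(d,n+1-i)$ for $1\le i\le n$. Let $w\in S_n$. If $w$ is 312-avoiding, then $\mathcal{D}_\lambda(w)$ is a convex polytope (in $\mathbb{Z}^{N}$, $N=\lambda_1+\cdots+\lambda_n$).
   Context: An $n$-partition is $\lambda=(\lambda_1\ge\cdots\ge\lambda_n\ge0)$; its Young diagram has $\lambda_i$ left-justified boxes in row $i$, and $(j,i)$ denotes the box in column $j$ and row $i$. $\zeta=(\zeta_1,\dots,\zeta_{\lambda_1})$ is the sequence of column lengths. $\mathcal{T}_\lambda$ is the set of semistandard tableaux of shape $\lambda$: fillings with entries in $\{1,\dots,n\}$, weakly increasing along rows and strictly increasing down columns. $T\le T'$ means $T(j,i)\le T'(j,i)$ for all boxes $(j,i)$. The one rowed form of $w\in S_n$ is $(x_1,\dots,x_n)$ with $x_i=w(i)$. $w$ is 312-avoiding if there do not exist $1\le a<b<c\le n$ with $x_b<x_c<x_a$. The key of $w$, $Y_\lambda(w)$, is the tableau of shape $\lambda$ each of whose columns of length $k$ consists of $x_1,\dots,x_k$ arranged in increasing order downward. A skew tableau is a filling of a skew diagram with entries in $\{1,\dots,n\}$, weakly increasing along rows and strictly increasing down columns. Its rectification is the (well-defined) semistandard tableau obtained by successive jeu de taquin slides into inside corners until none are left. It is frank if its column lengths are a rearrangement of those of its rectification. For $T\in\mathcal{T}_\lambda$, the right key $R(T)$ is the tableau of shape $\lambda$ whose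 $j$th column is the rightmost column of any frank skew tableau that rectifies to $T$ and whose rightmost column has length $\zeta_j$ (this is well defined). The set of Demazure tableaux is $\mathcal{D}_\lambda(w):=\{T\in\mathcal{T}_\lambda\mid R(T)\le Y_\lambda(w)\}$. Each tableau of shape $\lambda$ is regarded as a point of $\mathbb{Z}^N$ by reading its entries in some fixed order. A subset $\mathcal{S}\subseteq\mathbb{Z}^N$ is called a convex polytope if for some $m\ge1$ there exist a real $m\times N$ matrix $A$ and an $m\times1$ real column vector $b$ such that $\mathcal{S}$ is the set of integral solutions $x\in\mathbb{Z}^N$ of $Ax\le b$. *)

(* Defs.v *)
From mathcomp Require Import all_boot all_fingroup all_algebra.
From mathcomp Require Import reals.

Set Implicit Arguments.
Unset Strict Implicit.
Unset Printing Implicit Defensive.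

Import GRing.Theory Num.Theory.

(* Boxes are written (column, row) and rows and columns are numbered from 0;  *)
(* the values of tableaux and permutations are numbered from 1.               *)
Definition box := (nat * nat)%type.
Definition right_of (b : box) : box := (b.1.+1, b.2).
Definition below (b : box) : box := (b.1, b.2.+1).

(* A partition is a weakly decreasing sequence of row lengths; trailing zeros *)
(* are allowed and not significant.                                           *)
Definition is_partition (mu : seq nat) : bool := sorted geq mu.
Definition in_diagram (mu : seq nat) (b : box) : bool := b.1 < nth 0 mu b.2.

Definition column_lengths (mu : seq nat) : seq nat :=
  [seq count (fun l => j < l) mu | j <- iota 0 (head 0 mu)].

(* A skew tableau of shape outer / inner. The values of the filling outside   *)
(* the skew diagram are irrelevant. The inner shape is part of the data       *)
(* because it is not determined by the skew diagram.                          *)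
Record skew := Skew {
  outer : seq nat;
  inner : seq nat;
  filling : box -> nat }.

Definition in_skew (S : skew) (b : box) : bool :=
  in_diagram (outer S) b && ~~ in_diagram (inner S) b.

Definition is_skew_tableau (n : nat) (S : skew) : Prop :=
  [/\ is_partition (outer S),
      is_partition (inner S)
    & forall b, in_diagram (inner S) b -> in_diagram (outer S) b] /\
  [/\ forall b, in_skew S b -> 1 <= filling S b <= n,
      forall b, in_skew S b -> in_skew S (right_of b) ->
        filling S b <= filling S (right_of b)
    & forall b, in_skew S b -> in_skew S (below b) ->
        filling S b < filling S (below b)].

(* Fillings of left-justified shapes are given by their rows, top to bottom.  *)
Definition entry (T : seq (seq nat)) (b : box) : nat :=
  nth 0 (nth [::] T b.2) b.1.

Definition skew_of (T : seq (seq nat)) : skew := Skew (shape T) [::] (entry T).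

Definition is_tableau (n : nat) (lambda : seq nat) (T : seq (seq nat)) : Prop :=
  shape T = lambda /\ is_skew_tableau n (skew_of T).

(* Entrywise comparison of fillings of the same shape.                        *)
Definition tableau_le (T U : seq (seq nat)) : Prop :=
  forall b, in_diagram (shape T) b -> entry T b <= entry U b.

(* Columns from left to right, each read downward. Empty columns of a skew    *)
(* diagram are not counted as columns.                                        *)
Definition column (S : skew) (j : nat) : seq nat :=
  [seq filling S (j, i) | i <- iota 0 (size (outer S)) & in_skew S (j, i)].

Definition columns (S : skew) : seq (seq nat) :=
  [seq c <- [seq column S j | j <- iota 0 (head 0 (outer S))] | c != [::]].

Definition rightmost_column (S : skew) : seq nat := last [::] (columns S).

Definition inside_corner (S : skew) (b : box) : bool :=
  [&& in_diagram (inner S) b,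
      ~~ in_diagram (inner S) (right_of b) & ~~ in_diagram (inner S) (below b)].

(* [slide S f h g e]: with current filling f and the hole at h, sliding ends  *)
(* with filling g and the hole at e. The smaller neighbour moves into the     *)
(* hole, and in case of equality the one below does.                          *)
Inductive slide (S : skew) :
    (box -> nat) -> box -> (box -> nat) -> box -> Prop :=
| slide_stop f h :
    ~~ in_skew S (right_of h) -> ~~ in_skew S (below h) -> slide S f h f h
| slide_below f h g e :
    in_skew S (below h) ->
    (in_skew S (right_of h) -> f (below h) <= f (right_of h)) ->
    slide S [eta f with h |-> f (below h)] (below h) g e ->
    slide S f h g e
| slide_right f h g e :
    in_skew S (right_of h) ->
    (in_skew S (below h) -> f (right_of h) < f (below h)) ->
    slide S [eta f with h |-> f (right_of h)] (right_of h) g e ->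
    slide S f h g e.

(* To be used on boxes at the end of their row.                               *)
Definition remove_box (mu : seq nat) (b : box) : seq nat :=
  set_nth 0 mu b.2 (nth 0 mu b.2).-1.

(* The inside corner c joins the skew diagram and the final hole e leaves it. *)
Definition jdt_step (S S' : skew) : Prop :=
  exists c e g, [/\ inside_corner S c, slide S (filling S) c g e
    & S' = Skew (remove_box (outer S) e) (remove_box (inner S) c) g].

Inductive rectifies_to (T : seq (seq nat)) : skew -> Prop :=
| rectifies_done S :
    (forall c, ~~ inside_corner S c) ->
    (forall i, nth 0 (outer S) i = nth 0 (shape T) i) ->
    (forall b, in_diagram (shape T) b -> filling S b = entry T b) ->
    rectifies_to T S
| rectifies_step S S' :
    jdt_step S S' -> rectifies_to T S' -> rectifies_to T S.

Definition frank (S : skew) : Prop :=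
  exists2 T, rectifies_to T S
    & perm_eq [seq size c | c <- columns S] (column_lengths (shape T)).

Definition frank_witness (n : nat) (T : seq (seq nat)) (k : nat) (S : skew)
    : Prop :=
  [/\ is_skew_tableau n S, frank S, rectifies_to T S
    & size (rightmost_column S) = k].

(* K is the right key R(T). The first conjunct on columns asserts existence   *)
(* and the second independence of the choice of the frank skew tableau.       *)
Definition is_right_key (n : nat) (T K : seq (seq nat)) : Prop :=
  shape K = shape T /\
  forall j, j < size (column_lengths (shape T)) ->
    let k := nth 0 (column_lengths (shape T)) j in
    (exists S, frank_witness n T k S) /\
    (forall S, frank_witness n T k S ->
       rightmost_column S = column (skew_of K) j).

Definition one_rowed_form (n : nat) (w : 'S_n) : seq nat :=
  [seq (w i : nat).+1 | i <- enum 'I_n].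

Definition avoids_312 (n : nat) (w : 'S_n) : Prop :=
  ~ exists a b c : 'I_n, a < b < c /\ w b < w c < w a.

Definition key (lambda : seq nat) (n : nat) (w : 'S_n) : seq (seq nat) :=
  [seq [seq nth 0
          (sort leq (take (nth 0 (column_lengths lambda) j) (one_rowed_form w)))
          i
       | j <- iota 0 (nth 0 lambda i)]
  | i <- iota 0 (size lambda)].

Definition demazure (lambda : seq nat) (n : nat) (w : 'S_n)
    (T : seq (seq nat)) : Prop :=
  is_tableau n lambda T /\
  exists2 K, is_right_key n T K & tableau_le K (key lambda w).

(* The partition (d, ..., d, d-1, ..., 2, 1) with n parts.                    *)
Definition staircase (n d : nat) : seq nat := mkseq (fun i => minn d (n - i)) n.

(* Tableaux are read row by row, from top to bottom.                          *)
Definition tableau_points (N : nat) (D : seq (seq nat) -> Prop)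
    (x : 'cV[int]_N) : Prop :=
  exists2 T, D T & forall p : 'I_N, x p 0%R = Posz (nth 0 (flatten T) p).

Definition convex_polytope (R : realType) (N : nat) (P : 'cV[int]_N -> Prop)
    : Prop :=
  exists2 m : nat, 1 <= m &
  exists (A : 'M[R]_(m, N)) (b : 'cV[R]_m), forall x : 'cV[int]_N,
    P x <-> forall q : 'I_m, ((A *m map_mx intr x) q 0 <= b q 0)%R.

(* Main.v *)
Require Import Defs.
From mathcomp Require Import all_boot all_fingroup all_algebra.
From mathcomp Require Import reals zify.

(** For a 312-avoiding w, the Demazure tableaux turn out to be all the tableaux T
    with T <= Y(w), where Y(w) is the key of w. This is a system of linear
    inequalities in the entries of T. As T <= R(T) always holds, the point is
    that R(T) exists and that T <= Y(w) implies R(T) <= Y(w). Both follow from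
    a formula for the columns of R(T).

    A list of columns is read as a word, column by column from left to right,
    each column upwards. A jeu de taquin slide changes the word of a skew
    tableau only within its Knuth class ([slide_knuth]), and column insertion
    shows that a Knuth class contains at most one straight tableau with a given
    number of columns ([straight_unique]). Therefore rectification and frankness
    can be studied for lists of columns modulo Knuth equivalence. Rectification
    moves boxes to the left, which increases the sum of the squares of the
    column lengths unless the lengths are only permuted ([rectify_columns]); so
    every part of a frank list of columns is frank ([frank_infix]).

    Let t_1, ..., t_m be the columns of T and let C be the last column of a
    frank skew tableau that rectifies to T, of the same length as t_j, where
    t_1, ..., t_(j-1) are the columns longer than C. Rectifying other parts of
    the list, one finds that t_j, ..., t_m is Knuth equivalent to a list of
    columns in which C is both longest and last ([frank_last]). The maximal
    length of a strictly decreasing subword with letters >= y is invariant under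
    Knuth equivalence ([chain_knuth]), and in the second list it is the number
    of entries >= y of C ([last_column_count]). Hence C is determined by T and
    j, and it is the corresponding column of R(T). As t_j itself contains a
    decreasing subword, T <= R(T). The column C exists: adjacent columns can be
    exchanged until t_j is last ([longest_column_last]), and any list of columns
    belongs to a disconnected skew tableau ([antidiagonal_ok]), which
    rectifies to T because of the uniqueness ([rectifies_intro]).

    Finally, R(T) <= Y(w) now says that a decreasing subword of t_j, ..., t_m
    with letters >= y is no longer than the number of values >= y among the
    values of w that form the j-th column of Y(w). For T <= Y(w) this is proved by
    induction on the columns, and it is here that w has to avoid 312
    ([chain_le_key]). *)

Set Implicit Arguments.
Unset Strict Implicit.
Unset Printing Implicit Defensive.

(** * Knuth equivalence of words *)

Inductive knuth : seq nat -> seq nat -> Prop :=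
| knuth_refl u : knuth u u
| knuth_sym u v : knuth u v -> knuth v u
| knuth_trans u v t : knuth u v -> knuth v t -> knuth u t
| knuth_xzy a b x y z : x <= y < z ->
    knuth (a ++ [:: x; z; y] ++ b) (a ++ [:: z; x; y] ++ b)
| knuth_yxz a b x y z : x < y <= z ->
    knuth (a ++ [:: y; x; z] ++ b) (a ++ [:: y; z; x] ++ b).
#[local] Hint Resolve knuth_refl : core.

Lemma knuth_ctx a b u v : knuth u v -> knuth (a ++ u ++ b) (a ++ v ++ b).
Proof.
elim=> {u v} [//|u v _ /knuth_sym //|u v t _ /knuth_trans h _ /h //|c d x y z h|c d x y z h].
- by rewrite -!(catA c) !(catA a c); apply: knuth_xzy.
- by rewrite -!(catA c) !(catA a c); apply: knuth_yxz.
Qed.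

Lemma knuth_catl a u v : knuth u v -> knuth (a ++ u) (a ++ v).
Proof. by move/(knuth_ctx a [::]); rewrite !cats0. Qed.

Lemma knuth_catr b u v : knuth u v -> knuth (u ++ b) (v ++ b).
Proof. exact: (@knuth_ctx [::] b). Qed.

Lemma knuth_perm u v : knuth u v -> perm_eq u v.
Proof.
elim=> {u v} // [u v _|u v t _ h _ k|a b x y z _|a b x y z _].
- by rewrite perm_sym.
- exact: perm_trans h k.
- rewrite perm_cat2l perm_cat2r; apply/seq.permP => p /=; lia.
- rewrite perm_cat2l perm_cat2r; apply/seq.permP => p /=; lia.
Qed.

Local Notation col c := (sorted ltn c).

(** Two columns stand side by side as the columns of a straight tableau exactly
    when, for every t, the left one has at least as many entries <= t as the right
    one. This form of the row condition survives deleting and inserting entries,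
    and it includes the condition on the column lengths. *)
Definition straight2 (c d : seq nat) : Prop :=
  forall t, count (fun v => v <= t) d <= count (fun v => v <= t) c.

Lemma straight2_size c d : straight2 c d -> size d <= size c.
Proof.
move=> /(_ (foldr maxn 0 (c ++ d))).
have le v : v \in c ++ d -> v <= foldr maxn 0 (c ++ d).
  by elim: (c ++ d) => //= a s IH; rewrite inE => /orP[/eqP-> | /IH]; lia.
have full s : {subset s <= c ++ d} ->
    count (fun v => v <= foldr maxn 0 (c ++ d)) s = size s.
  move=> sub; apply/eqP; rewrite -all_count; apply/allP => v /sub; exact: le.
by rewrite !full // => v vs; rewrite mem_cat vs ?orbT.
Qed.

Lemma col_cons a c : col (a :: c) = all (fun v => a < v) c && col c.
Proof. by rewrite /= path_sortedE //; apply: ltn_trans. Qed.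

Lemma straight2_cons z y Z Y : col (z :: Z) -> col (y :: Y) ->
  straight2 (z :: Z) (y :: Y) -> z <= y /\ straight2 Z Y.
Proof.
rewrite !col_cons => /andP[/allP hz _] /andP[/allP hy _] h.
have zy : z <= y.
  move: (h y) => /=; rewrite leqnn; case: (leqP z y) => //= yz.
  rewrite (@eq_in_count _ _ pred0 Z) ?count_pred0 //.
  move=> v /hz /=; lia.
split=> // t; move: (h t) => /=; case: (leqP y t) => yt; first by lia.
rewrite (@eq_in_count _ _ pred0 Y) ?count_pred0 //.
move=> v /hy /=; lia.
Qed.

(** A letter smaller than Z passes through a column Y that could stand to the
    right of Z. Peeling the least letters z and y off Z and Y, one brings z next
    to y, exchanges y with b in front of z, and lets z and b pass the rest of Y
    by induction. *)
Lemma knuth_straight Z Y b : col Z -> col Y -> straight2 Z Y -> all (fun v => b < v) Z ->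
  knuth (rev Z ++ rev Y ++ [:: b]) (rev Z ++ b :: rev Y).
Proof.
elim: Y Z b => [|y Y IH] Z b cZ cY sZY bZ //.
case: Z cZ sZY bZ => [|z Z] cZ sZY bZ; first by have := sZY y; rewrite /= leqnn.
have [zy sZY'] := straight2_cons cZ cY sZY.
have bz : b < z by case/andP: bZ.
have cY' : col Y by move: cY; rewrite col_cons => /andP[].
have [zZ cZ'] : all (fun v => z < v) Z /\ col Z by apply/andP; rewrite -col_cons.
have h1 := IH _ _ cZ' cY' sZY' zZ.
have sZY2 : straight2 (z :: Z) Y.
  by move=> t; have /= := sZY t; lia.
have h2 := IH _ _ cZ cY' sZY2 bZ.
rewrite !rev_cons -!cats1 -!catA /=.
apply: (@knuth_trans _ (rev Z ++ rev Y ++ [:: z; y; b])).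
  by apply: knuth_sym; move: (knuth_catr [:: y; b] h1); rewrite -!catA.
apply: (@knuth_trans _ (rev Z ++ rev Y ++ [:: z; b; y])).
  rewrite !(catA (rev Z)); apply: knuth_sym.
  by apply: (@knuth_yxz (rev Z ++ rev Y) [::]); lia.
apply: (@knuth_trans _ (rev Z ++ z :: rev Y ++ [:: b; y])).
  by move: (knuth_catr [:: b; y] h1); rewrite -!catA.
move: (knuth_catr [:: y] h2); rewrite !rev_cons -!cats1 -!catA /= => h.
by apply: h.
Qed.

(** The image of the previous lemma under reversing words and the order of the
    letters. Here the columns are written as decreasing words. *)
Lemma knuth_straight_dual A X b : sorted gtn A -> sorted gtn X ->
  (forall t, count (fun v => t <= v) A <= count (fun v => t <= v) X) ->
  all (fun v => v < b) X ->
  knuth (A ++ b :: X) (b :: A ++ X).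
Proof.
have tr : transitive gtn by move=> x y z; lia.
elim: A X b => [|a A IH] X b // cA cX sAX bX.
case: X cX sAX bX => [|x X] cX sAX bX; first by have := sAX a; rewrite /= leqnn.
move: cA; rewrite /= path_sortedE // => /andP[/allP aA cA].
have ax : a <= x.
  move: cX; rewrite /= path_sortedE // => /andP[/allP xX _].
  have := sAX a; rewrite /= leqnn; case: (leqP a x) => //= xa.
  rewrite (@eq_in_count _ (fun v => a <= v) pred0 X) ?count_pred0 //.
  move=> v /xX /=; lia.
have xb : x < b by case/andP: bX.
have sAX2 t : count (fun v => t <= v) A <= count (fun v => t <= v) (x :: X).
  by have /= := sAX t; lia.
have sAX' t : count (fun v => t <= v) A <= count (fun v => t <= v) X.
  have /= := sAX t; case: (leqP t a) => ta; first by lia.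
  rewrite (@eq_in_count _ (fun v => t <= v) pred0 A) ?count_pred0 //.
  move=> v /aA /=; lia.
have [xX cX'] : all (fun v => v < x) X /\ sorted gtn X.
  by apply/andP; move: cX; rewrite /= path_sortedE.
have h1 := IH _ _ cA cX' sAX' xX.
have h2 := IH _ _ cA cX sAX2 bX.
apply: (@knuth_trans _ (a :: b :: A ++ x :: X)).
  by have := knuth_catl [:: a] h2.
apply: (@knuth_trans _ (a :: b :: x :: A ++ X)).
  by have := knuth_catl [:: a; b] h1.
apply: (@knuth_trans _ (b :: a :: x :: A ++ X)).
  by apply: (@knuth_xzy [::]); lia.
by apply: knuth_sym; have := knuth_catl [:: b; a] h1.
Qed.

(** Below the top of Z, the part A of the same column commutes with Y: its letters
    pass one by one, the largest first, each time with a longer column Z. *)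
Lemma knuth_exchange Z A Y : col Z -> col A -> col Y -> straight2 Z Y ->
  allrel ltn A Z -> knuth (rev Z ++ rev A ++ rev Y) (rev Z ++ rev Y ++ rev A).
Proof.
elim/last_ind: A Z => [|A a IH] Z cZ cA cY sZY AZ; first by rewrite cats0.
move: cA AZ; rewrite rev_rcons -cats1 allrel_catl allrel1l => cA /andP[AZ aZ].
have sZY' : straight2 (a :: Z) Y by move=> t; have /= := sZY t; lia.
have [cA' Aa] : col A /\ all (fun v => v < a) A.
  move: cA; rewrite !(sorted_pairwise ltn_trans) pairwise_cat allrel1r => /and3P[h h' _].
  by split=> //.
apply: (@knuth_trans _ (rev Z ++ a :: rev Y ++ rev A)).
  have := IH (a :: Z); rewrite rev_cons -cats1 -!catA; apply=> //.
    by rewrite col_cons aZ.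
  rewrite -[a :: Z]cat1s allrel_catr AZ andbT allrel1r //.
rewrite -[a :: _]cat1s.
apply: knuth_sym; have := knuth_catr (rev A) (knuth_straight cZ cY sZY aZ).
by rewrite -!catA.
Qed.

(** The effect of a horizontal slide on the two columns involved. The hole splits
    the left column into A above and Z below, and b is the entry to the right of
    the hole, between X and Y. Reading the rows below the hole before the others
    (Y before A) isolates the two moves of b: across A with the help of X, and
    across Y with the help of Z. *)
Lemma knuth_slide_right A Z X b Y :
  col Z -> col A -> col (X ++ b :: Y) -> straight2 Z Y ->
  (forall t, count (fun v => t <= v) A <= count (fun v => t <= v) X) ->
  allrel ltn A Z -> all (fun v => b < v) Z -> all (fun v => v < b) A ->
  knuth (rev (A ++ Z) ++ rev (X ++ b :: Y)) (rev (A ++ b :: Z) ++ rev (X ++ Y)).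
Proof.
move=> cZ cA cXY sZY sAX AZ bZ Ab.
move: cXY; rewrite (sorted_pairwise ltn_trans) pairwise_cat /= allrel_consr.
rewrite -(sorted_pairwise ltn_trans) -andbA => /and4P[Xb XY cX /andP[bY]].
rewrite -(sorted_pairwise ltn_trans) => cY.
rewrite !rev_cat !rev_cons -!cats1 -!catA /=.
have e1 := knuth_exchange cZ cA cY sZY AZ.
apply: (@knuth_trans _ (rev Z ++ rev Y ++ rev A ++ b :: rev X)).
  by have := knuth_catr (b :: rev X) e1; rewrite -!catA.
apply: (@knuth_trans _ (rev Z ++ rev Y ++ b :: rev A ++ rev X)).
  rewrite !(catA _ (rev Y)); apply: knuth_catl; apply: knuth_straight_dual.
  - by rewrite rev_sorted.
  - by rewrite rev_sorted.
  - by move=> t; rewrite !count_rev.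
  - by rewrite all_rev.
apply: (@knuth_trans _ (rev Z ++ b :: rev Y ++ rev A ++ rev X)).
  by have := knuth_catr (rev A ++ rev X) (knuth_straight cZ cY sZY bZ); rewrite -!catA.
have : knuth (rev (b :: Z) ++ rev A ++ rev Y) (rev (b :: Z) ++ rev Y ++ rev A).
  apply: knuth_exchange => //.
  - by rewrite col_cons bZ.
  - by move=> t; have /= := sZY t; lia.
  - by rewrite -[b :: Z]cat1s allrel_catr AZ andbT allrel1r.
move/knuth_sym/(knuth_catr (rev X)).
by rewrite !rev_cons -!cats1 -!catA.
Qed.

(** One step of Schensted insertion. It can be read from both ends: x enters the
    decreasing word U b V from the left and pushes out b, or b enters U x V from
    the right and pushes out x. *)
Lemma knuth_bump U x b V : sorted gtn (U ++ b :: V) -> x <= b -> all (fun v => v < x) V ->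
  knuth (x :: U ++ b :: V) (U ++ x :: V ++ [:: b]).
Proof.
have tr : transitive gtn by move=> ? ? ?; lia.
move=> cU xb Vx.
apply: (@knuth_trans _ (U ++ x :: b :: V)).
  elim: U cU => [|u U IH] //= cU.
  move: (cU); rewrite /= path_sortedE // => /andP[]; rewrite all_cat /= => /and3P[hU hb _] cU'.
  have {}IH := knuth_catl [:: u] (IH cU').
  apply: knuth_trans _ IH => /=.
  case: U cU' hU {cU} => [|u' U] /= cU' hU.
    by apply: (@knuth_xzy [::]); lia.
  apply: (@knuth_xzy [::]); case/andP: hU => ? _.
  move: cU'; rewrite path_sortedE // all_cat /= => /andP[/and3P[]]; lia.
have cV : sorted gtn V.
  by move: cU; rewrite !(sorted_pairwise tr) pairwise_cat /= => /and4P[].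
apply: knuth_catl => {U cU}.
elim: V x b xb Vx cV => [|v V IH] x b xb //= /andP[vx _].
rewrite path_sortedE // => /andP[vV cV].
apply: (@knuth_trans _ (x :: v :: b :: V)).
  by apply: knuth_sym; apply: (@knuth_yxz [::]); lia.
by apply: (@knuth_catl [:: x] (v :: b :: V)); apply: IH => //; lia.
Qed.

(** * Column insertion *)

(** Column insertion; the second component lists the letter that is pushed out, if
    there is one. *)
Fixpoint insert_letter (x : nat) (c : seq nat) : seq nat * seq nat :=
  if c is d :: c' then
    if x <= d then (x :: c', [:: d])
    else let r := insert_letter x c' in (d :: r.1, r.2)
  else ([:: x], [::]).

(** Inserts the letters of a word from right to left; the second component is the
    word of the letters pushed out, which are to be inserted in the next column. *)
Definition insert_word (u c : seq nat) : seq nat * seq nat :=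
  foldr (fun x s => let r := insert_letter x s.1 in (r.1, r.2 ++ s.2)) (c, [::]) u.

Lemma insert_word_cat u v c :
  insert_word (u ++ v) c =
  let r := insert_word v c in let s := insert_word u r.1 in (s.1, s.2 ++ r.2).
Proof.
elim: u => [|x u IH] /=; first by case: (insert_word v c).
by rewrite IH /= catA.
Qed.

Lemma insert_word_gt u d c : all (fun x => d < x) u ->
  insert_word u (d :: c) = (d :: (insert_word u c).1, (insert_word u c).2).
Proof. by elim: u => [|x u IH] //= /andP[dx /IH->] /=; rewrite leqNgt dx. Qed.

Lemma insert_letter_mem x c : {subset (insert_letter x c).1 <= x :: c}.
Proof.
elim: c => [|d c IH] v //=; case: ifP => _ /=.
  by rewrite !inE => /orP[->|->] //; rewrite !orbT.
rewrite !inE => /orP[->|/IH]; rewrite ?orbT // !inE => /orP[->|->] //.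
by rewrite !orbT.
Qed.

Lemma insert_letter_col x c : col c -> col (insert_letter x c).1.
Proof.
elim: c => [|d c IH] //; rewrite col_cons => /andP[dc cc] /=.
case: (leqP x d) => xd; rewrite [_.1]/= col_cons.
  by rewrite cc andbT; apply: sub_all dc => v; lia.
rewrite IH // andbT; apply/allP => v /insert_letter_mem; rewrite inE => /orP[/eqP->//|].
exact: (allP dc).
Qed.

Lemma insert_word_col u c : col c -> col (insert_word u c).1.
Proof. by move=> cc; elim: u => //= x u IH; apply: insert_letter_col. Qed.

Lemma insert_letter_out x c :
  (insert_letter x c).2 = [::] \/
  exists2 v, v \in c & (insert_letter x c).2 = [:: v].
Proof.
elim: c => [|d c [IH|[v vc IH]]] /=; [by left|case: ifP => _ /=..].
- by right; exists d; rewrite ?mem_head.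
- by left.
- by right; exists d; rewrite ?mem_head.
- by right; exists v; rewrite ?inE ?vc ?orbT.
Qed.

Lemma insert_letter_out2 y z c : col c -> y < z ->
  (insert_letter z (insert_letter y c).1).2 = [::] \/
  exists y' z', [/\ (insert_letter y c).2 = [:: y'],
                   (insert_letter z (insert_letter y c).1).2 = [:: z'],
                   y' \in c & y' < z'].
Proof.
move=> + yz; elim: c => [|d c IH].
  by move=> _ /=; rewrite leqNgt yz; left.
rewrite col_cons => /andP[/allP dc cc] /=; case: (leqP y d) => yd /=.
  rewrite leqNgt yz /=; case: (insert_letter_out z c) => [->|[z' /dc z'c ->]]; [by left|right].
  by exists d, z'; rewrite mem_head.
have -> : (z <= d) = false by lia.
case: (IH cc) => [|[y' [z' [h1 h2 h3 h4]]]]; [by left|right].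
by exists y', z'; rewrite inE h3 orbT.
Qed.

Lemma insert_word_xzy x y z c : col c -> x <= y < z ->
  (insert_word [:: x; z; y] c).1 = (insert_word [:: z; x; y] c).1 /\
  knuth (insert_word [:: x; z; y] c).2 (insert_word [:: z; x; y] c).2.
Proof.
move=> + xyz; have [xy [zy zx]] : x <= y /\ (z <= y) = false /\ (z <= x) = false by lia.
elim: c => [|d c IH].
  by move=> _ /=; rewrite zy xy /= xy /= zx.
rewrite col_cons => /andP[dc cc].
case: (ltnP d x) => dx.
  have [h1 h2] := IH cc; rewrite !insert_word_gt /= ?andbT; try lia.
  by split; [move: h1 => /= -> | move: h2].
case: (leqP y d) => yd.
  rewrite /= yd /= zy xy /= xy /= zx; split=> //.
  case: (insert_letter_out z c) => [->|[v /(allP dc) dv ->]] //=.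
  by apply: (@knuth_xzy [::] [::]); lia.
have zd : (z <= d) = false by lia.
rewrite /= leqNgt yd /= dx /= zx zd /= dx; split=> //=.
have yz : y < z by lia.
case: (insert_letter_out2 cc yz) => [->|[y' [z' [-> -> /(allP dc) dy' y'z']]]] //=.
by apply: (@knuth_xzy [::] [::]); lia.
Qed.

Lemma insert_letter_out_ge x c v : v \in (insert_letter x c).2 -> x <= v.
Proof.
elim: c => [|d c IH] //=; case: ifP => [xd|_] /=; last exact: IH.
by rewrite inE => /eqP->.
Qed.

Lemma insert_letter_out3 y z c : y <= z ->
  exists2 y', y' \in (insert_letter z c).1
    & (insert_letter y (insert_letter z c).1).2 = [:: y'] /\ y' <= z.
Proof.
move=> yz; elim: c => [|d c [y' h1 [h2 h3]]].
  by exists z; rewrite ?mem_head //= yz.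
rewrite /=; case: (leqP z d) => zd /=.
  by exists z; rewrite ?mem_head // yz.
case: (leqP y d) => yd; first by exists d; [rewrite mem_head | split => //; lia].
by exists y'; rewrite ?inE ?h1 ?orbT.
Qed.

(** If no entry of the column lies in the interval from x to z, then inserting x
    and z in either order pushes out z itself and the next two entries, in orders
    which differ by the other elementary relation. *)
Lemma insert_word_yxz x y z c : col c -> x < y <= z ->
  (insert_word [:: y; x; z] c).1 = (insert_word [:: y; z; x] c).1 /\
  knuth (insert_word [:: y; x; z] c).2 (insert_word [:: y; z; x] c).2.
Proof.
move=> + xyz; have [xz [yz [zx yx]]] :
  x <= z /\ y <= z /\ (z <= x) = false /\ (y <= x) = false by lia.
elim: c => [|d c IH].
  by move=> _ /=; rewrite zx xz /= yx yz.
rewrite col_cons => /andP[dc cc].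
case: (ltnP d x) => dx.
  have [h1 h2] := IH cc; rewrite !insert_word_gt /= ?andbT; try lia.
  by split; [move: h1 => /= -> | move: h2].
case: (leqP z d) => zd.
  (* nothing in c lies between x and z *)
  rewrite /= zd dx /= xz zx /= yx.
  case: c dc {IH cc} => [|e c] /=; first by rewrite yz.
  case/andP=> de _.
  have [ze ye] : z <= e /\ y <= e by lia.
  rewrite ze ye /= yz; split=> //.
  by apply: knuth_sym; apply: (@knuth_xzy [::] [::]); lia.
rewrite /= dx leqNgt zd /= zx dx /= yx; split=> //=.
have [y' /insert_letter_mem y'c [-> y'z]] := insert_letter_out3 c yz.
have := @insert_letter_out_ge z c; case: (insert_letter_out z c) => [->|[z' _ ->]] //= /(_ _ (mem_head _ _)) zz'.
apply: (@knuth_yxz [::] [::]).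
have : d < y' by move: y'c; rewrite inE => /orP[/eqP->//|/(allP dc)].
lia.
Qed.

Lemma insert_word_ctx a b u v c :
  (insert_word u (insert_word b c).1).1 = (insert_word v (insert_word b c).1).1 ->
  knuth (insert_word u (insert_word b c).1).2 (insert_word v (insert_word b c).1).2 ->
  (insert_word (a ++ u ++ b) c).1 = (insert_word (a ++ v ++ b) c).1 /\
  knuth (insert_word (a ++ u ++ b) c).2 (insert_word (a ++ v ++ b) c).2.
Proof.
move=> e k; rewrite !insert_word_cat /= e; split=> //.
by apply: knuth_catl; apply: knuth_catr.
Qed.

(** Equivalent words leave the same column and push out equivalent words, so the
    insertion tableau can be compared column by column. *)
Lemma insert_word_knuth u v c : col c -> knuth u v ->
  (insert_word u c).1 = (insert_word v c).1 /\ knuth (insert_word u c).2 (insert_word v c).2.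
Proof.
move=> cc uv; elim: uv c cc => {u v}.
- by [].
- by move=> u v _ IH c /IH[-> /knuth_sym].
- by move=> u v t _ IH1 _ IH2 c cc; have [-> h] := IH1 c cc;
    have [-> h'] := IH2 c cc; split=> //; apply: knuth_trans h'.
- move=> a b x y z h c cc.
  by have [e k] := insert_word_xzy (insert_word_col b cc) h; apply: insert_word_ctx.
- move=> a b x y z h c cc.
  by have [e k] := insert_word_yxz (insert_word_col b cc) h; apply: insert_word_ctx.
Qed.

(** The number of columns is fixed in advance, which makes the recursion
    structural; what the last column pushes out is lost. *)
Fixpoint insert_columns (u : seq nat) (cs : seq (seq nat)) : seq (seq nat) :=
  if cs is c :: cs' then (insert_word u c).1 :: insert_columns (insert_word u c).2 cs'
  else [::].

Lemma insert_columns_knuth u v cs : all (fun c => col c) cs -> knuth u v ->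
  insert_columns u cs = insert_columns v cs.
Proof.
elim: cs u v => //= c cs IH u v /andP[cc ccs] uv.
by have [-> /(IH _ _ ccs)->] := insert_word_knuth cc uv.
Qed.

Definition word (cs : seq (seq nat)) : seq nat := flatten [seq rev c | c <- cs].

Fixpoint straight (cs : seq (seq nat)) : Prop :=
  if cs is c :: cs' then col c /\ straight2 c (head [::] cs') /\ straight cs' else True.

Lemma insert_word_straight2 c d : col c -> col d -> straight2 c d ->
  insert_word (rev c) d = (c, rev d).
Proof.
elim: c d => [|a c IH] d.
  by case: d => // e d _ _ /(_ e) /=; rewrite leqnn.
move=> cac cd scd; rewrite rev_cons -cats1 insert_word_cat /=.
have [ac cc] : all (fun v => a < v) c /\ col c by apply/andP; rewrite -col_cons.
case: d cd scd => [|e d] cd scd.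
  by rewrite /= insert_word_gt ?all_rev // IH.
have [ae sc] := straight2_cons cac cd scd.
have cd' : col d by move: cd; rewrite col_cons => /andP[].
by rewrite /= ae /= insert_word_gt ?all_rev // IH //= rev_cons -cats1.
Qed.

Lemma insert_word_word cs : straight cs ->
  insert_word (word cs) [::] = (head [::] cs, word (behead cs)).
Proof.
elim: cs => [|c cs IH] //= [cc [sc scs]].
rewrite /word /= insert_word_cat IH //= insert_word_straight2 //; first by case: cs {IH sc scs}.
by case: cs scs {sc IH} => //= d ds [].
Qed.

Lemma insert_columns_word cs : straight cs ->
  insert_columns (word cs) (nseq (size cs) [::]) = cs.
Proof.
elim: cs => [|c cs IH] // scs; rewrite [nseq _ _]/= [LHS]/= insert_word_word //= IH //.
by case: scs => _ [].
Qed.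

(** Column insertion of the word of a straight list of columns gives the list back,
    and it depends only on the Knuth class. *)
Lemma straight_unique cs cs' : straight cs -> straight cs' -> size cs = size cs' ->
  knuth (word cs) (word cs') -> cs = cs'.
Proof.
move=> scs scs' es /(@insert_columns_knuth _ _ (nseq (size cs) [::])).
rewrite insert_columns_word // es insert_columns_word //; apply.
by apply/allP => c /nseqP[-> _].
Qed.

(** * Rectifying a list of columns *)

Lemma gtn_trans : transitive gtn.
Proof. by move=> x y z /=; lia. Qed.

Lemma col_consP a c : col (a :: c) -> all (fun v => a < v) c /\ col c.
Proof. by rewrite col_cons => /andP. Qed.

(** The rectification of two columns. The first of the new lengths is at least both
    old ones, and if the left column does not grow then nothing has moved. *)
Lemma rectify_pair A B : col A -> col B -> exists A' B',
  [/\ col A', col B', straight2 A' B' & knuth (rev A ++ rev B) (rev A' ++ rev B')] /\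
  [/\ {subset B' <= B}, size A <= size A', size B <= size A'
    & size A' = size A -> A' = A /\ B' = B].
Proof.
elim: B A => [|d ds IH] A cA cB; first by exists A, [::]; split; split.
have [dds cds] := col_consP cB.
case: A cA => [|a As] cA; first by exists (d :: ds), [::]; rewrite cats0; split; split.
have [aAs cAs] := col_consP cA.
have mem_PO As' P O : knuth (rev As' ++ rev ds) (rev P ++ rev O) ->
    forall v, v \in P ++ O -> v \in As' \/ v \in ds.
  move=> /knuth_perm/perm_mem h v; have := h v; rewrite !mem_cat !mem_rev => <-.
  by move/orP.
case: (leqP a d) => ad.
  have [P [O [[cP cO sPO k] [sO sP sP' sE]]]] := IH As cAs cds.
  have aPO v : v \in P ++ O -> a < v.
    by move/(mem_PO _ _ _ k) => [/(allP aAs)//|/(allP dds)]; lia.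
  have dO : all (fun v => d < v) O by apply/allP => v /sO /(allP dds).
  have cdO : col (d :: O) by rewrite col_cons dO.
  have bump C : col (d :: C) -> knuth (a :: rev C ++ [:: d]) (rev C ++ [:: a; d]).
    move=> cC; apply: (@knuth_bump (rev C) a d [::]) => //.
    by rewrite cats1 -rev_cons rev_sorted.
  exists (a :: P), (d :: O); split; split => //.
  - rewrite col_cons cP andbT; apply/allP => v vP; apply: aPO.
    by rewrite mem_cat vP.
  - by move=> t /=; have := sPO t; lia.
  - rewrite !rev_cons -!cats1 -!catA.
    apply: (knuth_trans (knuth_catl _ (bump _ cB))).
    apply: knuth_sym; apply: (knuth_trans (knuth_catl _ (bump _ cdO))).
    by rewrite !catA; apply: knuth_catr; apply: knuth_sym.
  - by move=> v; rewrite !inE => /orP[->//|/sO->]; rewrite orbT.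
  - by move=> [/sE[-> ->]].
have [P [O [[cP cO sPO k] [sO sP sP' sE]]]] := IH (a :: As) cA cds.
have dP : all (fun v => d < v) P.
  apply/allP => v vP; have : v \in P ++ O by rewrite mem_cat vP.
  move/(mem_PO _ _ _ k) => [|/(allP dds)//].
  by rewrite inE => /orP[/eqP->//|/(allP aAs)]; lia.
exists (d :: P), O; split; split => //.
- by rewrite col_cons dP.
- by move=> t /=; have := sPO t; lia.
- rewrite [rev (d :: ds)]rev_cons [rev (d :: P)]rev_cons -!cats1 catA.
  apply: (knuth_trans (knuth_catr _ k)); rewrite -!catA.
  exact: knuth_straight.
- by move=> v /sO; rewrite inE => ->; rewrite orbT.
- by rewrite /= in sP *; lia.
- by rewrite /= in sP *; lia.
Qed.

Lemma word_cons c cs : word (c :: cs) = rev c ++ word cs.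
Proof. by []. Qed.

Lemma word_cat cs ds : word (cs ++ ds) = word cs ++ word ds.
Proof. by rewrite /word map_cat flatten_cat. Qed.

Definition sizes (cs : seq (seq nat)) := [seq size c | c <- cs].
(** Sums of squares of column lengths measure how far boxes have moved to the left:
    rectification never decreases them, and frankness means that they stay the
    same. *)
Definition sumsq (cs : seq (seq nat)) := sumn [seq size c ^ 2 | c <- cs].

Definition spread (cs ds : seq (seq nat)) : Prop :=
  perm_eq (sizes cs) (sizes ds) \/ sumsq cs < sumsq ds.

Lemma sumsq_cat cs ds : sumsq (cs ++ ds) = sumsq cs + sumsq ds.
Proof. by rewrite /sumsq map_cat sumn_cat. Qed.

Lemma perm_sumsq cs ds : perm_eq (sizes cs) (sizes ds) -> sumsq cs = sumsq ds.
Proof.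
have e bs : sumsq bs = sumn [seq s ^ 2 | s <- sizes bs] by rewrite /sumsq -map_comp.
by rewrite !e => /(perm_map (fun s => s ^ 2))/perm_sumn.
Qed.

Lemma spread_trans cs ds es : spread cs ds -> spread ds es -> spread cs es.
Proof.
move=> [p|l] [q|m].
- by left; apply: perm_trans q.
- by right; rewrite (perm_sumsq p).
- by right; rewrite -(perm_sumsq q).
- by right; apply: ltn_trans m.
Qed.

Lemma spread_cat a cs ds b : spread cs ds -> spread (a ++ cs ++ b) (a ++ ds ++ b).
Proof.
move=> [p|l]; [left|right].
  by rewrite /sizes !map_cat perm_cat2l perm_cat2r.
by rewrite !sumsq_cat; lia.
Qed.

Local Notation cols cs := (all (fun c => col c) cs).

Lemma straight_or_move cs : cols cs -> straight cs \/
  exists a b A B A' B', cs = a ++ [:: A; B] ++ b /\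
    [/\ col A', col B', straight2 A' B' & knuth (word [:: A; B]) (word [:: A'; B'])] /\
    [/\ size A < size A', size B <= size A' & size A' + size B' = size A + size B].
Proof.
elim: cs => [|c cs IH]; [by left|move=> /= /andP[cc ccs]].
have [scs|] := IH ccs; last first.
  by move=> [a [b [A [B [A' [B' [-> h]]]]]]]; right; exists (c :: a), b, A, B, A', B'.
case: cs ccs scs {IH} => [|d cs] ccs scs; first by left.
have cd : col d by case/andP: ccs.
have [A' [B' [[cA' cB' s k] [_ le le' e]]]] := rectify_pair cc cd.
move: le; rewrite leq_eqVlt => /orP[/eqP es|lt].
  have [eA eB] := e (esym es); left; move: s; rewrite eA eB => s; by split.
right; exists [::], cs, c, d, A', B'; split => //; split; split => //.
  by rewrite /word /= !cats0.
by have := perm_size (knuth_perm k); rewrite !size_cat !size_rev.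
Qed.

(** Each box contributes the number of columns to its left. Rectifying two adjacent
    columns that do not yet fit moves boxes to the left and decreases this number. *)
Fixpoint weight (cs : seq (seq nat)) : nat :=
  if cs is c :: cs' then sumn (sizes cs') + weight cs' else 0.

Lemma sizes_cat cs ds : sizes (cs ++ ds) = sizes cs ++ sizes ds.
Proof. exact: map_cat. Qed.

Lemma rectify_columns cs : cols cs -> exists ds,
  [/\ straight ds, size ds = size cs, knuth (word cs) (word ds) & spread cs ds].
Proof.
have [m] := ubnP (weight cs); elim: m cs => // m IH cs lem ccs.
have [scs|] := straight_or_move ccs; first by exists cs; split => //; left.
move=> [a [b [A [B [A' [B' [e [[cA' cB' s k] [lt le es]]]]]]]]].
have [||ds [sds szs kds dds]] := IH (a ++ [:: A'; B'] ++ b).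
- suff : weight (a ++ [:: A'; B'] ++ b) < weight cs by lia.
  rewrite e; elim: (a) => [|c a' IHa] /=; first by lia.
  by move: IHa; rewrite !sizes_cat /= !sumn_cat /=; lia.
- by move: ccs; rewrite e !all_cat /= cA' cB' -!andbA => /and4P[-> _ _ ->].
exists ds; split => //.
- by rewrite szs e !size_cat.
- apply: knuth_trans kds; rewrite e !word_cat; exact: knuth_ctx.
apply: spread_trans dds; rewrite e; apply: spread_cat.
case: (ltnP (size B) (size A')) => lt'.
  by right; rewrite /sumsq /=; nia.
have eAB : size A' = size B by lia.
left; rewrite /sizes /= eAB; have -> : size B' = size A by lia.
by rewrite (perm_catC [:: size A] [:: size B]).
Qed.

(** * Frank lists of columns *)

Definition frank_cols (cs : seq (seq nat)) : Prop :=
  cols cs /\ exists T, [/\ straight T, size T = size cs,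
    knuth (word cs) (word T) & perm_eq (sizes cs) (sizes T)].

Lemma straight_cols cs : straight cs -> cols cs.
Proof. by elim: cs => //= c cs IH [-> [_ /IH]]. Qed.

Lemma straight_sizes cs : straight cs -> sorted geq (sizes cs).
Proof.
elim: cs => [|c [|d cs] IH] // [cc [s scs]].
by apply/andP; split; [exact: straight2_size | exact: IH].
Qed.

(** The straight list equivalent to ds has at least the sum of squares of ds, but
    by uniqueness it is the rectification of cs, whose sum of squares is that of
    cs. *)
Lemma frank_sumsq cs ds : frank_cols cs -> cols ds -> size ds = size cs ->
  knuth (word cs) (word ds) -> ~ sumsq cs < sumsq ds.
Proof.
move=> [ccs [T [sT zT kT pT]]] cds es k lt.
have [U [sU zU kU]] := rectify_columns cds.
have eU : U = T.
  apply: straight_unique => //; first by rewrite zU es zT.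
  by apply: knuth_trans kT; apply: knuth_sym; apply: knuth_trans kU.
rewrite eU => -[/perm_sumsq|]; rewrite -(perm_sumsq pT) => h.
  by rewrite h ltnn in lt.
by have := ltn_trans lt h; rewrite ltnn.
Qed.

(** If a part of the list spread out under rectification, replacing it by its
    rectification would increase the sum of squares of the whole list. *)
Lemma frank_infix a cs b : frank_cols (a ++ cs ++ b) -> frank_cols cs.
Proof.
move=> f; have [/[dup] ccs] := f; rewrite !all_cat => /and3P[ca c cb] _; split=> //.
have [U [sU zU kU [p|lt]]] := rectify_columns c; first by exists U.
exfalso; apply: (frank_sumsq f (ds := a ++ U ++ b)).
- by rewrite !all_cat ca cb straight_cols.
- by rewrite !size_cat zU.
- by rewrite !word_cat; apply: knuth_ctx.
- by rewrite !sumsq_cat; lia.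
Qed.

(** Otherwise the rectification would have a first column longer than both. *)
Lemma frank_pair A B : frank_cols [:: A; B] -> size B <= size A -> straight2 A B.
Proof.
move=> [/= /and3P[cA cB _] [T [sT zT kT pT]]] le.
have [A' [B' [[cA' cB' s k] [_ lA lB e]]]] := rectify_pair cA cB.
have eT : [:: A'; B'] = T.
  apply: straight_unique => //; apply: knuth_trans kT; apply: knuth_sym.
  by rewrite /word /= !cats0.
rewrite -eT /sizes /= in pT.
have eA : size A' = size A.
  have : size A' \in [:: size A; size B] by rewrite (perm_mem pT) mem_head.
  by rewrite !inE => /orP[]/eqP; lia.
by have [<- <-] := e eA.
Qed.

Lemma frank_sorted cs : frank_cols cs -> sorted geq (sizes cs) -> straight cs.
Proof.
elim: cs => // c cs IH f srt.
have fcs : frank_cols cs by apply: (@frank_infix [:: c] cs [::]); rewrite cats0.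
split; first by case: f => /andP[].
split; last by apply: IH fcs _; move: srt => /= /path_sorted.
case: cs f srt {IH fcs} => [|d cs] // f /= /andP[le _].
by apply: frank_pair le; apply: (@frank_infix [::] _ cs).
Qed.

Lemma frank_equiv cs ds : frank_cols cs -> cols ds -> size ds = size cs ->
  knuth (word ds) (word cs) -> perm_eq (sizes ds) (sizes cs) -> frank_cols ds.
Proof.
move=> [_ [T [sT zT kT pT]]] cds es k p; split=> //; exists T; split=> //.
- by rewrite es.
- exact: knuth_trans kT.
- exact: perm_trans pT.
Qed.

Lemma sorted_geq_split k (s : seq nat) : sorted geq s ->
  all (fun v => k < v) (take (count (fun v => k < v) s) s) /\
  all (fun v => v <= k) (drop (count (fun v => k < v) s) s).
Proof.
elim: s => // v s IH srt; have [IH1 IH2] := IH (path_sorted srt).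
rewrite /=; case: ltnP => [kv|vk] /=; first by rewrite kv.
have vs : all (fun u => u <= k) s.
  move: srt; rewrite /= path_sortedE; last by move=> ? ? ? /=; lia.
  by move=> /andP[/allP h _]; apply/allP => u /h /=; lia.
rewrite (@eq_in_count _ (fun v => k < v) pred0 s) ?count_pred0 /= ?vk //.
by move=> u /(allP vs) /=; lia.
Qed.

(** The columns Q may be rectified without affecting C or frankness. The result
    starts with the columns longer than C; rectifying all the others together with
    C keeps their lengths, so the whole becomes a frank list with decreasing
    lengths, hence straight, hence T. Thus C is the last column of a list
    equivalent to the part B of T that remains when the columns longer than C are
    removed, and in B it has maximal length. *)
Lemma frank_last T Q C : straight T -> size T = (size Q).+1 ->
  frank_cols (rcons Q C) -> knuth (word (rcons Q C)) (word T) ->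
  let B := drop (count (fun c => size C < size c) T) T in
  exists2 Q2, knuth (word (rcons Q2 C)) (word B) & size (head [::] B) = size C.
Proof.
move=> sT zT f k.
have [ccQ _] := f; have [cC cQ] : col C /\ cols Q by apply/andP; rewrite -all_rcons.
have [_ [Q' [sQ' zQ' kQ' pQ']]] : frank_cols Q.
  by apply: (@frank_infix [::] Q [:: C]); rewrite cats1.
have kQ'C : knuth (word (rcons Q' C)) (word (rcons Q C)).
  by rewrite -!cats1 !word_cat; apply: knuth_catr; apply: knuth_sym.
have f' : frank_cols (rcons Q' C).
  apply: (frank_equiv f) => //.
  - by rewrite all_rcons cC straight_cols.
  - by rewrite !size_rcons zQ'.
  - by rewrite -!cats1 !sizes_cat perm_cat2r perm_sym.
pose j := count (fun c => size C < size c) Q'.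
pose Q1 := take j Q'; pose Q2 := drop j Q'.
have [g1 g2] : all (fun v => size C < v) (sizes Q1) /\ all (fun v => v <= size C) (sizes Q2).
  have := sorted_geq_split (size C) (straight_sizes sQ').
  by rewrite count_map /sizes /Q1 /Q2 map_take map_drop.
have eQ' : Q1 ++ Q2 = Q' by rewrite cat_take_drop.
have f2 : frank_cols (rcons Q2 C).
  by apply: (@frank_infix Q1 _ [::]); rewrite cats0 -rcons_cat eQ'.
have [cQ2 [T2 [sT2 zT2 kT2 pT2]]] := f2.
have kk : knuth (word (Q1 ++ T2)) (word (rcons Q' C)).
  by rewrite -eQ' rcons_cat !word_cat; apply: knuth_catl; apply: knuth_sym.
have pT : perm_eq (sizes (Q1 ++ T2)) (sizes (rcons Q' C)).
  by rewrite -eQ' rcons_cat !sizes_cat perm_cat2l perm_sym.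
have szT2 : size (Q1 ++ T2) = size (rcons Q' C).
  by rewrite -eQ' rcons_cat !size_cat zT2.
have srt : sorted geq (sizes Q1).
  by rewrite /sizes /Q1 map_take; apply/take_sorted/straight_sizes.
have tr : transitive geq by move=> ? ? ? /=; lia.
have T2le v : v \in sizes T2 -> v <= size C.
  rewrite -(perm_mem pT2) /sizes map_rcons mem_rcons inE => /orP[/eqP-> //|].
  exact: (allP g2).
have sQT : straight (Q1 ++ T2).
  apply: frank_sorted.
    apply: (frank_equiv f') => //; rewrite all_cat (straight_cols sT2) andbT.
    by apply/allP => c /mem_take; apply: (allP (straight_cols sQ')).
  rewrite sizes_cat (sorted_pairwise tr) pairwise_cat -!(sorted_pairwise tr) srt.
  rewrite straight_sizes // !andbT; apply/allrelP => u v /(allP g1) /= h /T2le; lia.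
have eT : Q1 ++ T2 = T.
  apply: straight_unique => //; first by rewrite szT2 size_rcons zQ' zT.
  by apply: (knuth_trans kk); apply: knuth_trans k.
have ej : count (fun c => size C < size c) T = size Q1.
  rewrite -eT count_cat.
  rewrite -(count_map size (fun v => size C < v) Q1).
  rewrite -(count_map size (fun v => size C < v) T2).
  have -> : count (fun v => size C < v) [seq size i | i <- T2] = 0.
    apply/eqP; rewrite -leqn0 leqNgt -has_count; apply/hasPn => v /T2le; lia.
  by move: g1; rewrite all_count => /eqP->; rewrite addn0 size_map.
exists Q2; first by rewrite ej -eT drop_size_cat.
rewrite ej -eT drop_size_cat //.
have CT2 : size C \in sizes T2.
  by rewrite -(perm_mem pT2) /sizes map_rcons mem_rcons mem_head.
case: T2 sT2 T2le CT2 {zT2 kT2 pT2 kk pT szT2 sQT eT ej} => // c T2 sT2 T2le.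
have := straight_sizes sT2; rewrite /= path_sortedE // => /andP[/allP h _].
have := T2le (size c) (mem_head _ _).
by rewrite inE => le /orP[/eqP->//|/h /=]; lia.
Qed.

(** * Decreasing subwords *)

(** Strictly decreasing subwords whose letters are at least y. *)
Definition chain (y : nat) (p u : seq nat) : bool :=
  [&& subseq p u, sorted gtn p & all (fun v => y <= v) p].

Lemma subseq_catP (p u v : seq nat) : subseq p (u ++ v) ->
  exists p1 p2, [/\ p = p1 ++ p2, subseq p1 u & subseq p2 v].
Proof.
move=> /subseqP[m sm ->]; exists (mask (take (size u) m) u), (mask (drop (size u) m) v).
rewrite !mask_subseq; split=> //; rewrite -mask_cat ?cat_take_drop //.
by rewrite size_takel // sm size_cat leq_addr.
Qed.

Lemma gtn_cat (p q : seq nat) :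
  sorted gtn (p ++ q) = [&& allrel gtn p q, sorted gtn p & sorted gtn q].
Proof. by rewrite !(sorted_pairwise gtn_trans) pairwise_cat. Qed.

(** A chain q inside a longer chain can be exchanged for another one as soon as
    the new letters lie between the extreme letters of q. *)
Definition replaceable (m' q : seq nat) : Prop :=
  exists q', [/\ subseq q' m', sorted gtn q',
    forall v, v \in q' -> (exists2 u, u \in q & u <= v) /\ (exists2 u, u \in q & v <= u)
  & size q' = size q].

Lemma replaceable_sub m' q : subseq q m' -> sorted gtn q -> replaceable m' q.
Proof. by move=> s c; exists q; split=> // v vq; split; exists v. Qed.

Lemma chain_ctx a b m m' :
  (forall q, subseq q m -> sorted gtn q -> replaceable m' q) ->
  forall y p, chain y p (a ++ m ++ b) ->
     exists2 p', chain y p' (a ++ m' ++ b) & size p' = size p.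
Proof.
move=> H y p /and3P[/subseq_catP[pa [p2 [-> sa /subseq_catP[q [pb [-> sq sb]]]]]]].
rewrite gtn_cat gtn_cat allrel_catr => /and3P[/andP[aq ab] ca /and3P[qb cq cb]].
rewrite !all_cat => /and3P[ya yq yb].
have [q' [sq' cq' sqz es]] := H q sq cq.
exists (pa ++ q' ++ pb); last by rewrite !size_cat es.
apply/and3P; split; first by rewrite !cat_subseq.
  rewrite gtn_cat gtn_cat allrel_catr ab ca cq' cb /= !andbT; apply/andP; split.
    apply/allrelP => u v ua /sqz[_ [w wq vw]].
    by have /= := allrelP aq _ _ ua wq; move: vw; clear; lia.
  apply/allrelP => v u /sqz[[w wq vw] _] ub.
  by have /= := allrelP qb _ _ wq ub; move: vw; clear; lia.
rewrite !all_cat ya yb andbT /=; apply/allP => v /sqz[[w /(allP yq) /= yw wv] _].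
exact: leq_trans wv.
Qed.

Lemma replaceable3 a b c m' : {subset [:: a; b; c] <= m'} -> ~~ (c < b < a) ->
  (b < a -> replaceable m' [:: a; b]) -> (c < a -> replaceable m' [:: a; c]) ->
  (c < b -> replaceable m' [:: b; c]) ->
  forall q, subseq q [:: a; b; c] -> sorted gtn q -> replaceable m' q.
Proof.
move=> sub nabc ab ac bc q.
case/subseqP=> -[|[] [|[] [|[] []]]] //= _ -> /=; rewrite ?andbT //.
- by case/andP=> ba cb; rewrite cb ba in nabc.
- by move=> _; apply: replaceable_sub; rewrite // sub1seq sub ?inE ?eqxx ?orbT.
- by move=> _; apply: replaceable_sub; rewrite // sub1seq sub ?inE ?eqxx ?orbT.
- by move=> _; apply: replaceable_sub; rewrite // sub1seq sub ?inE ?eqxx ?orbT.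
- by move=> _; apply: replaceable_sub; rewrite ?sub0seq.
Qed.

(** The only chain destroyed by an elementary relation is z x: it is replaced by
    z y in the first relation and by y x in the second. *)
Lemma chain_knuth u v : knuth u v -> forall y p,
  (chain y p u -> exists2 p', chain y p' v & size p' = size p) /\
  (chain y p v -> exists2 p', chain y p' u & size p' = size p).
Proof.
elim=> {u v}.
- by move=> u y p; split=> h; exists p.
- by move=> u v _ IH y p; have [h1 h2] := IH y p.
- move=> u v t _ IH1 _ IH2 y p; split.
    by move=> /(proj1 (IH1 y p))[q /(proj1 (IH2 y q))[r h <-] <-]; exists r.
  by move=> /(proj2 (IH2 y p))[q /(proj2 (IH1 y q))[r h <-] <-]; exists r.
- move=> a b x y z /andP[xy yz] t p; have xz := leq_ltn_trans xy yz.
  split; apply: chain_ctx; apply: replaceable3.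
  + by move=> v; rewrite !inE => /or3P[]->; rewrite ?orbT.
  + by rewrite (ltnNge z x) (ltnW xz) andbF.
  + by rewrite ltnNge (ltnW xz).
  + by rewrite ltnNge xy.
  + by move=> _; apply: replaceable_sub;
      [exact: (mask_subseq [:: true; false; true] [:: z; x; y]) | rewrite /= yz].
  + by move=> v; rewrite !inE => /or3P[]->; rewrite ?orbT.
  + by rewrite ltnNge xy.
  + move=> _; exists [:: z; y]; split=> //.
    * exact: (mask_subseq [:: false; true; true] [:: x; z; y]).
    * by rewrite /= yz.
    move=> v; rewrite !inE => /orP[]/eqP->; split.
    * by exists x; rewrite ?inE ?eqxx ?orbT // ltnW.
    * by exists z; rewrite ?inE ?eqxx ?orbT.
    * by exists x; rewrite ?inE ?eqxx ?orbT.
    * by exists z; rewrite ?inE ?eqxx ?orbT // ltnW.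
  + by move=> _; apply: replaceable_sub;
      [exact: (mask_subseq [:: false; true; true] [:: x; z; y]) | rewrite /= yz].
  + by rewrite ltnNge xy.
- move=> a b x y z /andP[xy yz] t p; have xz := leq_trans xy yz.
  split; apply: chain_ctx; apply: replaceable3.
  + by move=> v; rewrite !inE => /or3P[]->; rewrite ?orbT.
  + by rewrite (ltnNge z x) (ltnW xz).
  + by move=> _; apply: replaceable_sub;
      [exact: (mask_subseq [:: true; false; true] [:: y; z; x]) | rewrite /= xy].
  + by rewrite ltnNge yz.
  + by rewrite ltnNge (ltnW xz).
  + by move=> v; rewrite !inE => /or3P[]->; rewrite ?orbT.
  + by rewrite (ltnNge z y) yz andbF.
  + by rewrite ltnNge yz.
  + by move=> _; apply: replaceable_sub;
      [exact: (mask_subseq [:: true; true; false] [:: y; x; z]) | rewrite /= xy].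
  + move=> _; exists [:: y; x]; split=> //.
    * exact: (mask_subseq [:: true; true; false] [:: y; x; z]).
    * by rewrite /= xy.
    move=> v; rewrite !inE => /orP[]/eqP->; split.
    * by exists x; rewrite ?inE ?eqxx ?orbT // ltnW.
    * by exists z; rewrite ?inE ?eqxx ?orbT.
    * by exists x; rewrite ?inE ?eqxx ?orbT.
    * by exists z; rewrite ?inE ?eqxx ?orbT // ltnW.
Qed.

Lemma straight2_lt c d t : straight2 c d ->
  count (fun v => v < t) d <= count (fun v => v < t) c.
Proof.
case: t => [|t] s; last exact: s.
by rewrite (@eq_count _ _ pred0) // count_pred0.
Qed.

(** Passing to the next column, a decreasing subword moves strictly upwards in the
    rows. In terms of counts: the part after the first column uses letters below
    the least letter b taken from that column, and the column has at least as many
    entries below b as the next one. *)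
Lemma straight_chain T y p x : straight T -> chain y p (word T) ->
  all (fun v => v < x) p -> size p <= count (fun v => v < x) (head [::] T).
Proof.
elim: T p x => [|c T IH] p x; first by move=> _ /and3P[]; rewrite subseq0 => /eqP->.
move=> [cc [s sT]] /and3P[/subseq_catP[p1 [p2 [-> s1 s2]]]].
rewrite gtn_cat !all_cat size_cat /= => /and3P[p12 c1 c2] /andP[y1 y2] /andP[x1 x2].
case: p1 s1 p12 c1 y1 x1 => [|a p1] s1 p12 c1 y1 x1.
  rewrite add0n; apply: leq_trans (straight2_lt x s); apply: IH => //; exact/and3P.
pose b := last a p1.
have bmin v : v \in a :: p1 -> b <= v.
  rewrite /b; elim: (p1) a c1 v {s1 p12 y1 x1 b} => [|a' q IHq] a /= c1 v.
    by rewrite inE => /eqP->.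
  case/andP: c1 => aa' cq; rewrite inE => /orP[/eqP->|]; last exact: IHq.
  by apply: leq_trans (IHq _ cq a' (mem_head _ _)) (ltnW aa').
have b1 : b \in a :: p1 by rewrite /b mem_last.
have h2 : size p2 <= count (fun v => v < b) (head [::] T).
  apply: IH => //; first exact/and3P.
  by apply/allP => v vp; have := allrelP p12 _ _ b1 vp.
have h3 := leq_trans h2 (straight2_lt b s).
have h1 : size (a :: p1) <= count (fun v => (b <= v) && (v < x)) c.
  rewrite -size_filter; apply: uniq_leq_size.
    by apply: (sorted_uniq gtn_trans) c1 => v /=; rewrite ltnn.
  move=> v vp; rewrite mem_filter bmin //= (allP x1) //=.
  by have /mem_subseq/(_ v vp) := s1; rewrite mem_rev.
have bx : b < x by apply: (allP x1).
have h4 : count (fun v => (b <= v) && (v < x)) c + count (fun v => v < b) c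
   <= count (fun v => v < x) c.
  by elim: (c) => //= v c'; move: bx; clear; lia.
by apply: leq_trans h4; apply: leq_add.
Qed.

Lemma straight_chain_size T y p : straight T -> chain y p (word T) ->
  size p <= size (head [::] T).
Proof.
move=> sT cp; apply: leq_trans (count_size (fun v => v < (foldr maxn 0 p).+1) _).
apply: straight_chain cp _ => //; apply/allP; elim: (p) => //= a q IH v.
by rewrite inE => /orP[/eqP-> | /IH]; clear; lia.
Qed.

Lemma col_count_eq c d : col c -> col d ->
  (forall y, count (fun v => y <= v) c = count (fun v => y <= v) d) -> c = d.
Proof.
move=> cc cd h; apply: (irr_sorted_eq ltn_trans ltnn cc cd) => x.
have e s : count (pred1 x) s = count (fun v => x <= v) s - count (fun v => x.+1 <= v) s.
  have -> : count (fun v => x <= v) s = count (pred1 x) s + count (fun v => x.+1 <= v) s.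
    by elim: s => //= v s ->; clear; lia.
  by rewrite addnK.
by rewrite -!has_pred1 !has_count !e !h.
Qed.

Lemma rev_filter_lt C y : col C ->
  rev C = filter (fun v => y <= v) (rev C) ++ filter (fun v => v < y) (rev C).
Proof.
rewrite -rev_sorted; elim: (rev C) => // v s IH srt /=.
have /andP[/allP h cs] : all (fun u => u < v) s && sorted gtn s.
  by move: srt; rewrite /= path_sortedE //; apply: gtn_trans.
case: leqP => yv /=; first by rewrite -IH.
rewrite (@eq_in_filter _ _ pred0); last first.
  by move=> u /h /=; move: yv; clear; lia.
rewrite filter_pred0 /=; congr cons; symmetry; apply/all_filterP/allP => u /h /=.
by move: yv; clear; lia.
Qed.

(** A chain with letters >= y can be prolonged by the entries of C that are < y,
    because C is read last. The longest chain has the length of C, so no chain with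
    letters >= y is longer than the corresponding part of C. *)
Lemma last_column_count Q C B : col C -> straight B -> knuth (word (rcons Q C)) (word B) ->
  size (head [::] B) = size C -> forall y,
  (exists2 p, chain y p (word B) & size p = count (fun v => y <= v) C) /\
  (forall p, chain y p (word B) -> size p <= count (fun v => y <= v) C).
Proof.
move=> cC sB k zB y.
have ew : word (rcons Q C) = word Q ++ rev C by rewrite -cats1 word_cat /word /= cats0.
split.
  have := proj1 (chain_knuth k y (filter (fun v => y <= v) (rev C))).
  rewrite ew size_filter count_rev; apply; apply/and3P; split.
  - exact: subseq_trans (filter_subseq _ _) (suffix_subseq _ _).
  - by apply: sorted_filter gtn_trans _ _ _; rewrite rev_sorted.
  - exact: filter_all.
move=> p /(proj2 (chain_knuth k y p))[p'].
rewrite ew => /and3P[/subseq_catP[p1 [p2 [-> s1 s2]]]].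
rewrite gtn_cat all_cat size_cat => /and3P[p12 c1 c2] /andP[y1 y2] <-.
pose q := p1 ++ p2 ++ filter (fun v => v < y) (rev C).
have : chain 0 q (word (rcons Q C)).
  have sr : sorted gtn (rev C) by rewrite rev_sorted.
  have s2' : subseq p2 (filter (fun v => y <= v) (rev C)) by rewrite subseq_filter y2.
  rewrite ew; apply/and3P; split; last exact/allP.
    apply: cat_subseq => //; rewrite [X in subseq _ X](rev_filter_lt y cC).
    exact: cat_subseq.
  rewrite /q !gtn_cat allrel_catr p12 c1 c2 /= (sorted_filter gtn_trans) // andbT.
  have lt s : all (fun v => y <= v) s -> allrel gtn s (filter (fun v => v < y) (rev C)).
    move=> /allP ys; apply/allrelP => u v /ys yu; rewrite mem_filter => /andP[vy _].
    exact: leq_trans yu.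
  by rewrite !lt.
case/(proj1 (chain_knuth k 0 q)) => r /(straight_chain_size sB).
rewrite zB => + er; rewrite er !size_cat addnA size_filter count_rev.
have -> : size C = count (fun v => y <= v) C + count (fun v => v < y) C.
  by elim: (C) => //= v s ->; clear; lia.
by rewrite leq_add2r.
Qed.

(** * Moving a longest column to the end *)

Lemma has_split (p : pred nat) s : has p s ->
  exists U x V, [/\ s = U ++ x :: V, all (predC p) U & p x].
Proof.
elim: s => //= a s IH; case: (boolP (p a)) => [pa _|na /= /IH[U [x [V [-> h px]]]]].
  by exists [::], a, s.
by exists (a :: U), x, V; rewrite /= na.
Qed.

Lemma gtn_consP a c : sorted gtn (a :: c) -> all (fun v => v < a) c /\ sorted gtn c.
Proof. by rewrite /= path_sortedE => [/andP|]; last exact: gtn_trans. Qed.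

(** The inverse of the rectification of two columns of increasing lengths. The
    letters of B enter A from the right, the largest first. By the row condition
    each of them pushes out a letter of A, and these letters form the new left
    column. As B survives in the new right column, that column still fits with
    whatever fits with B. *)
Lemma swap_pair A B : sorted gtn A -> sorted gtn B ->
  (forall t, count (fun v => v <= t) B <= count (fun v => v <= t) A) ->
  exists X C, [/\ sorted gtn X, sorted gtn C, knuth (A ++ B) (X ++ C),
                  size X = size B & size C = size A] /\
    {subset B <= C} /\ (forall v, v \in X -> v \in A /\ v <= head 0 B).
Proof.
elim: B A => [|b B IH] A cA cB h; first by exists [::], A; rewrite cats0.
have [bB cB'] := gtn_consP cB.
have hasA : has (fun v => v <= b) A by rewrite has_count; apply: leq_trans (h b); rewrite /= leqnn.
have [U [x [V [eA Ub xb]]]] := has_split hasA.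
have {}Ub : all (fun v => b < v) U by apply: sub_all Ub => v /=; rewrite -ltnNge.
have [Vx cV] : all (fun v => v < x) V /\ sorted gtn V.
  by apply: gtn_consP; move: cA; rewrite eA gtn_cat => /and3P[].
have cU : sorted gtn U by move: cA; rewrite eA gtn_cat => /and3P[].
have cA1 : sorted gtn (U ++ b :: V).
  rewrite gtn_cat cU /= path_sortedE ?cV ?andbT; last exact: gtn_trans.
  apply/andP; split; last by apply: sub_all Vx => v /=; move: xb; clear; lia.
  apply/allrelP => u v /(allP Ub) /= bu; rewrite inE => /orP[/eqP->//|/(allP Vx)].
  by move: bu xb; clear; lia.
have [|X [C [[cX cC k zX zC] [sBC hX]]]] := IH (U ++ b :: V) cA1 cB'.
  move=> t; have := h t; have := h b; rewrite eA !count_cat /=.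
  case: (leqP b t) => bt.
    have -> : x <= t by exact: leq_trans bt.
    by clear; lia.
  rewrite leqnn xb.
  have e0 s : all (fun v => b < v) s -> count (fun v => v <= t) s = 0.
    by move=> /allP bs; rewrite (@eq_in_count _ _ pred0) ?count_pred0 // => v /bs /=; move: bt; clear; lia.
  have e1 s : all (fun v => v < b) s -> count (fun v => v <= b) s = size s.
    by move=> hs; apply/eqP; rewrite -all_count; apply: sub_all hs => v /ltnW.
  rewrite (e0 U) // (e1 B) //.
  have Vb : all (fun v => v < b) V by apply: sub_all Vx => v; move: xb; clear; lia.
  rewrite (e1 V) //.
  have -> : count (fun v => v <= b) U = 0.
    by rewrite (@eq_in_count _ _ pred0) ?count_pred0 // => v /(allP Ub) /=; clear; lia.
  case: (leqP x t) => xt; last by clear; lia.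
  have -> : count (fun v => v <= t) V = size V.
    by apply/eqP; rewrite -all_count; apply: sub_all Vx => v; move: xt; clear; lia.
  by move=> h1 _; apply: leq_trans (count_size _ _) _; move: h1; clear; lia.
have Xb v : v \in X -> v < b.
  case: (B) bB zX hX => [|b' B'] bB zX hX vX; first by case: (X) zX vX.
  have [_ /= le] := hX v vX; case/andP: bB => + _; exact: leq_ltn_trans.
have XV v : v \in X -> v \in V.
  move=> vX; have [+ _] := hX v vX; have := Xb v vX.
  rewrite mem_cat inE => vb /or3P[/(allP Ub)|/eqP e|//]; move: vb; rewrite ?e; clear; lia.
have cxX : sorted gtn (x :: X).
  rewrite /= path_sortedE ?cX ?andbT; last exact: gtn_trans.
  by apply/allP => v /XV /(allP Vx).
have kA : knuth (A ++ b :: B) (x :: X ++ C).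
  have -> : A ++ b :: B = (U ++ x :: V ++ [:: b]) ++ B by rewrite eA -!catA /= -catA.
  apply: (@knuth_trans _ ((x :: U ++ b :: V) ++ B)).
    apply: knuth_catr; apply: knuth_sym; exact: knuth_bump.
  exact: (knuth_catl [:: x] k).
exists (x :: X), C; split; [split => //=|split].
- by rewrite zX.
- by rewrite zC eA !size_cat.
- move=> v; rewrite inE => /orP[/eqP->|/sBC//].
  have := perm_mem (knuth_perm k) b; rewrite !mem_cat mem_head orbT /=.
  by case: (boolP (b \in X)) => [/Xb|//]; rewrite ltnn.
- move=> v; rewrite inE => /orP[/eqP->|vX]; rewrite eA mem_cat inE.
    by rewrite eqxx orbT.
  by rewrite (XV v vX) !orbT /= ltnW ?Xb.
Qed.

(** The first column is exchanged with each of the following ones in turn. *)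
Lemma longest_column_last c T : straight (c :: T) -> exists Q C,
  [/\ cols Q, col C, knuth (word (rcons Q C)) (word (c :: T)), size C = size c
    & sizes Q = sizes T].
Proof.
elim: T c => [|d T IH] c /=; first by move=> [cc _]; exists [::], c.
move=> [cc [s sdT]]; have [cd [sd sT]] := sdT.
have [|||X [D [[cX cD k zX zD] [sub _]]]] := @swap_pair (rev c) (rev d).
- by rewrite rev_sorted.
- by rewrite rev_sorted.
- by move=> t; rewrite !count_rev.
rewrite size_rev in zX; rewrite size_rev in zD.
have sD : straight (rev D :: T).
  split; [by rewrite rev_sorted|split => // t].
  apply: leq_trans (sd t) _; rewrite count_rev -!size_filter; apply: uniq_leq_size.
    by apply/filter_uniq/(sorted_uniq ltn_trans ltnn).
  by move=> v; rewrite !mem_filter -(mem_rev d) => /andP[-> /sub].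
have [Q [C [cQ cC kQ zC zQ]]] := IH _ sD.
exists (rev X :: Q), C; split => //=.
- by rewrite cQ andbT rev_sorted.
- rewrite !word_cons revK; apply: (@knuth_trans _ (X ++ D ++ word T)).
    by apply: knuth_catl; apply: (knuth_trans kQ); rewrite word_cons revK.
  by rewrite !catA; apply/knuth_catr/knuth_sym.
- by rewrite zC size_rev.
- by rewrite size_rev zX zQ.
Qed.

(** * Keys of 312-avoiding permutations *)

(** Avoidance of the pattern 312 for a sequence of numbers. *)
Definition avoids (x : seq nat) : Prop :=
  forall a b c, a < b < c -> c < size x ->
    ~ (nth 0 x b < nth 0 x c < nth 0 x a).

(** For an increasing column c, this is entrywise comparison with the column of the
    same length of the key. *)
Definition below_key (x c : seq nat) : Prop :=
  size c <= size x /\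
  forall y, count (fun v => y <= v) c <= count (fun v => y <= v) (take (size c) x).

Lemma straight_rcons B d : straight (rcons B d) -> straight B.
Proof.
elim: B => //= c B IH [cc [s sB]]; split=> //; split; last exact: IH.
by case: B s {IH sB}.
Qed.

Lemma count_lt_ge y (s : seq nat) :
  size s = count (fun v => y <= v) s + count (fun v => v < y) s.
Proof. by elim: s => //= v s ->; clear; lia. Qed.

Lemma max_exists (s : seq nat) : s != [::] ->
  exists2 m, m \in s & {in s, forall v, v <= m}.
Proof.
elim: s => // a [|b s] IH _; first by exists a; rewrite ?mem_head // => v; rewrite inE => /eqP->.
have [m ms h] := IH isT; case: (leqP a m) => am.
  by exists m; [rewrite inE ms orbT | move=> v; rewrite inE => /orP[/eqP->|/h]].
exists a; first exact: mem_head.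
by move=> v; rewrite inE => /orP[/eqP->//|/h vm]; apply: leq_trans vm (ltnW am).
Qed.

(** The bound that uses the avoidance of 312, by induction on the last column d
    that the chain meets. Let d have i0 entries < y. These entries prolong the
    chain, so it has at most (size c - i0) letters; this suffices if the first
    (size c) values of x contain at most i0 values < y. Otherwise such a value b is
    among them but not among the first (size d) ones. Let M be the maximum of the
    latter. A value v with y <= v <= M that occurs after the first (size c)
    positions would form the pattern M, b, v. So all these values are in the key
    column, and they are at least as many as the letters of the chain in that
    range. The letters > M avoid d and are counted by induction. *)
Lemma chain_le_key n (x : seq nat) c T y p :
  uniq x -> (forall v, v \in x = (0 < v <= n)) -> avoids x -> straight (c :: T) ->
  {in c :: T, forall d, below_key x d} ->
  chain y p (word (c :: T)) -> size p <= count (fun v => y <= v) (take (size c) x).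
Proof.
move=> ux ex av; elim/last_ind: T y p => [|T d IH] y p sB bk.
  rewrite /word /= cats0 => /and3P[s cp yp].
  apply: leq_trans (proj2 (bk c (mem_head _ _)) y).
  rewrite -size_filter; apply: uniq_leq_size.
    by apply: (sorted_uniq gtn_trans) cp => v /=; rewrite ltnn.
  move=> v vp; rewrite mem_filter (allP yp) //=.
  by have /mem_subseq/(_ v vp) := s; rewrite mem_rev.
rewrite -rcons_cons in sB bk *.
have {}IH := IH _ _ (straight_rcons sB) _.
have bk' : {in c :: T, forall e, below_key x e}.
  by move=> e eT; apply: bk; rewrite mem_rcons inE eT orbT.
have [ld bd] : below_key x d by apply: bk; rewrite mem_rcons mem_head.
have [lc _] : below_key x c by apply: bk; rewrite mem_rcons inE mem_head orbT.
have cd : col d.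
  by have := straight_cols sB; rewrite all_rcons => /andP[].
rewrite -cats1 word_cat [word [:: d]]/word /= cats0.
move=> /and3P[/subseq_catP[p1 [p2 [ep s1 s2]]] cp yp].
have ch1 z q : subseq q p1 -> sorted gtn q -> all (fun v => z <= v) q -> chain z q (word (c :: T)).
  by move=> sq cq zq; apply/and3P; split=> //; apply: subseq_trans s1.
move: (cp) (yp); rewrite {1}ep gtn_cat => /and3P[p12 c1 c2].
rewrite {1}ep all_cat => /andP[y1 y2].
case: (altP (p2 =P [::])) => [e2|n2].
  by rewrite ep e2 cats0; apply: IH => //; apply: ch1.
(* the elements of d below y extend the chain *)
have size_p : size p + count (fun v => v < y) d <= size c.
  rewrite -(count_rev _ d) -size_filter -size_cat.
  apply: (@straight_chain_size (rcons (c :: T) d) 0) => //.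
  rewrite -cats1 word_cat [word [:: d]]/word [flatten _]/= cats0.
  apply/and3P; split; last exact/allP.
    rewrite ep -catA; apply: cat_subseq => //; rewrite [X in subseq _ X](rev_filter_lt y cd).
    by apply: cat_subseq => //; rewrite subseq_filter y2.
  rewrite gtn_cat; apply/and3P; split=> //; last by rewrite (sorted_filter gtn_trans) ?rev_sorted.
  apply/allrelP => u v /(allP yp) yu; rewrite mem_filter => /andP[vy _].
  exact: leq_trans yu.
have zk : size (take (size c) x) = size c by rewrite size_takel.
have zl : size (take (size d) x) = size d by rewrite size_takel.
case: (leqP (count (fun v => v < y) (take (size c) x)) (count (fun v => v < y) d)) => cmp.
  by move: size_p cmp (count_lt_ge y (take (size c) x)); rewrite zk; clear; lia.
have dc : size d <= size c.
  have := straight_sizes sB; rewrite /sizes map_rcons /= => h.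
  have tr : transitive geq by move=> ? ? ? /=; clear; lia.
  move: h; rewrite path_sortedE // all_rcons => /andP[/andP[/= ? _] _]; done.
have etake : take (size c) x = take (size d) x ++ take (size c - size d) (drop (size d) x).
  by rewrite -{1}(subnKC dc) takeD.
have pos : 0 < count (fun v => v < y) (take (size c - size d) (drop (size d) x)).
  move: cmp (bd y) (count_lt_ge y d) (count_lt_ge y (take (size d) x)).
  by rewrite etake count_cat zl; clear; lia.
have [b bin by_] : exists2 b, b \in take (size c - size d) (drop (size d) x) & b < y.
  by apply/hasP; rewrite has_count.
have bdrop := mem_take bin.
have bc : b \in take (size c) x by rewrite etake mem_cat bin orbT.
have [M MP Mmax] : exists2 m, m \in take (size d) x & {in take (size d) x, forall v, v <= m}.
  apply: max_exists; rewrite -size_eq0 zl; apply: contraNneq n2 => d0.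
  by move: s2; rewrite (size0nil d0) subseq0 => /eqP->.
have dM : {in d, forall v, v <= M}.
  move=> v vd; rewrite leqNgt; apply/negP => Mv.
  have : 0 < count (fun u => M < u) d by rewrite -has_count; apply/hasP; exists v.
  rewrite ltnNge; apply/negP/negPn; apply: leq_trans (bd M.+1) _.
  rewrite leqn0 -leqn0 leqNgt -has_count; apply/hasPn => u /Mmax.
  by rewrite -leqNgt.
have mem1 v : v \in x -> 0 < v <= n by rewrite ex.
have inP v : y <= v <= M -> v \in take (size c) x.
  move=> /andP[yv vM].
  have vx : v \in x.
    rewrite ex (leq_trans _ yv) ?(leq_trans _ by_) //=.
    by apply: leq_trans vM _; have /andP[] := mem1 _ (mem_take MP).
  have bx : b \in x by apply: mem_drop bdrop.
  have Mx := mem_take MP.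
  have := MP; rewrite in_take // => Mi.
  have bi : size d <= index b x.
    rewrite leqNgt -in_take //; apply/negP => bt.
    by have := ux; rewrite -{1}(cat_take_drop (size d) x) cat_uniq => /and3P[_ /hasPn/(_ _ bdrop)]; rewrite bt.
  rewrite in_take //; rewrite leqNgt; apply/negP => cv.
  have iv : index v x < size x by rewrite index_mem.
  apply: (av (index M x) (index b x) (index v x)) => //.
    apply/andP; split; first exact: leq_trans bi.
    by move: bc cv; rewrite in_take //; apply: leq_trans.
  rewrite !nth_index // (leq_trans by_ yv) /= ltn_neqAle vM andbT.
  by apply: contraTneq cv => ->; rewrite -leqNgt; apply: leq_trans (leq_trans Mi dc).
have p2d v : v \in p2 -> v \in d by move/(mem_subseq s2); rewrite mem_rev.
have big : size (filter (fun v => M < v) p) <= count (fun v => M < v) (take (size c) x).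
  have -> : filter (fun v => M < v) p = filter (fun v => M < v) p1.
    rewrite ep filter_cat (@eq_in_filter _ _ pred0 p2) ?filter_pred0 ?cats0 //.
    by move=> v /p2d /dM /=; clear; lia.
  apply: IH => //; apply: ch1; first exact: filter_subseq.
    exact: sorted_filter gtn_trans _ _ _.
  exact: filter_all.
have small : size (filter (fun v => v <= M) p) <=
    count (fun v => (y <= v) && (v <= M)) (take (size c) x).
  rewrite -size_filter; apply: uniq_leq_size.
    by apply/filter_uniq; apply: (sorted_uniq gtn_trans) cp => v /=; rewrite ltnn.
  move=> v; rewrite !mem_filter => /andP[vM /(allP yp) /= yv].
  by rewrite yv vM inP // yv.
have yM : y <= M.
  case: p2 n2 {s2 ep p12 c2} y2 p2d => // v p2 _ /andP[yv _] h.
  by apply: leq_trans yv (dM _ (h _ (mem_head _ _))).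
have : size p = size (filter (fun v => M < v) p) + size (filter (fun v => v <= M) p).
  by rewrite !size_filter; elim: (p) => //= v q ->; clear; lia.
have : count (fun v => y <= v) (take (size c) x) =
  count (fun v => M < v) (take (size c) x) + count (fun v => (y <= v) && (v <= M)) (take (size c) x).
  by elim: (take _ x) => //= v q ->; move: yM; clear; lia.
by move=> -> ->; apply: leq_add.
Qed.

(** * Skew diagrams and their slides *)

Lemma is_partP mu : is_partition mu <-> forall i, nth 0 mu i.+1 <= nth 0 mu i.
Proof.
split=> [/(sortedP 0) h i|h]; last by apply/(sortedP 0) => i _; apply: h.
case: (ltnP i.+1 (size mu)) => lt; first exact: h.
by rewrite nth_default.
Qed.

Lemma part_nth mu i i' : is_partition mu -> i <= i' -> nth 0 mu i' <= nth 0 mu i.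
Proof.
move=> /is_partP h /subnKC <-; elim: (i' - i) => [|k IH]; first by rewrite addn0.
by rewrite addnS; apply: leq_trans IH.
Qed.

Lemma diagram_mono mu b b' : is_partition mu -> in_diagram mu b ->
  b'.1 <= b.1 -> b'.2 <= b.2 -> in_diagram mu b'.
Proof.
rewrite /in_diagram => p db le1 le2.
by apply: leq_ltn_trans le1 _; apply: leq_trans db _; apply: part_nth.
Qed.

Lemma diagram_size mu b : in_diagram mu b -> b.2 < size mu.
Proof. by rewrite /in_diagram ltnNge => h; rewrite ltnNge; apply: contra h => /(nth_default 0) ->. Qed.

Lemma diagram_head mu b : is_partition mu -> in_diagram mu b -> b.1 < head 0 mu.
Proof.
move=> p; rewrite -nth0 /in_diagram => h; apply: leq_trans h _; exact: part_nth.
Qed.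

Lemma box_eta (b : box) : (b.1, b.2) = b. Proof. by case: b. Qed.

Lemma diagram_remove mu c b : in_diagram mu c -> ~~ in_diagram mu (right_of c) ->
  in_diagram (remove_box mu c) b = in_diagram mu b && (b != c).
Proof.
case: c b => [j i] [j' i']; rewrite /in_diagram /remove_box /right_of /= => h1 h2.
rewrite nth_set_nth /= xpair_eqE; case: eqP => [->|_]; last by rewrite andbF andbT.
rewrite andbT; move: h1 h2; clear; lia.
Qed.

Lemma remove_part mu c : is_partition mu -> in_diagram mu c ->
  ~~ in_diagram mu (right_of c) -> ~~ in_diagram mu (below c) ->
  is_partition (remove_box mu c).
Proof.
case: c => j i; rewrite /in_diagram /remove_box /right_of /below /= => /is_partP p h1 h2 h3.
apply/is_partP => k; rewrite !nth_set_nth /=.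
case: eqP => [e|_]; case: eqP => [e'|_] //; move: h1 h2 h3 (p k); rewrite -?e ?e'; clear; lia.
Qed.

Lemma size_remove mu c : in_diagram mu c -> size (remove_box mu c) = size mu.
Proof.
by move/diagram_size => h; rewrite /remove_box size_set_nth; apply/maxn_idPr.
Qed.

(** Monotonicity for all pairs of comparable boxes, not only for adjacent ones, so
    that it still makes sense when a box in the middle is a hole. *)
Definition increasing (D : pred box) (f : box -> nat) : Prop :=
  forall b b', D b -> D b' -> b.1 <= b'.1 -> b.2 <= b'.2 ->
  f b <= f b' /\ (b.2 < b'.2 -> f b < f b').

Definition in_range n (D : pred box) (f : box -> nat) : Prop :=
  forall b, D b -> 1 <= f b <= n.

Lemma skew_convex S b b' x : is_partition (outer S) -> is_partition (inner S) ->
  in_skew S b -> in_skew S b' -> b.1 <= x.1 -> b.2 <= x.2 -> x.1 <= b'.1 -> x.2 <= b'.2 ->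
  in_skew S x.
Proof.
move=> po pi /andP[_ nb] /andP[ob' _] l1 l2 l3 l4; apply/andP; split.
  exact: diagram_mono ob' l3 l4.
by apply: contraNN nb => h; apply: diagram_mono h l1 l2.
Qed.

Lemma skew_increasing n S : is_skew_tableau n S -> increasing (in_skew S) (filling S).
Proof.
move=> [[po pi _] [_ row colm]].
have rows j i k : in_skew S (j, i) -> in_skew S (j + k, i) ->
    filling S (j, i) <= filling S (j + k, i).
  move=> s; elim: k => [|k IH] s'; first by rewrite addn0.
  have sk : in_skew S (j + k, i).
    by apply: skew_convex s s' _ _ _ _ => //=; rewrite ?leq_addr // leq_add2l.
  apply: leq_trans (IH sk) _; rewrite addnS; apply: row => //.
  by rewrite /right_of /= -addnS.
have cls j i k : in_skew S (j, i) -> in_skew S (j, i + k) ->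
    filling S (j, i) + k <= filling S (j, i + k).
  move=> s; elim: k => [|k IH] s'; first by rewrite !addn0.
  have sk : in_skew S (j, i + k).
    by apply: skew_convex s s' _ _ _ _ => //=; rewrite ?leq_addr // leq_add2l.
  rewrite addnS; apply: leq_ltn_trans (IH sk) _; rewrite addnS; apply: colm => //.
  by rewrite /below /= -addnS.
move=> [j i] [j' i'] /= s s' lj li.
have sc : in_skew S (j', i) by apply: skew_convex s s' _ _ _ _.
have := rows j i (j' - j); rewrite subnKC // => /(_ s sc) h1.
have := cls j' i (i' - i); rewrite subnKC // => /(_ sc s') h2.
by move: h1 h2; clear; lia.
Qed.

Lemma increasing_skew n S :
  is_partition (outer S) -> is_partition (inner S) ->
  (forall b, in_diagram (inner S) b -> in_diagram (outer S) b) ->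
  in_range n (in_skew S) (filling S) -> increasing (in_skew S) (filling S) ->
  is_skew_tableau n S.
Proof.
move=> po pi sub rg inc; split; split=> //.
- by move=> b s s'; have [] := inc _ _ s s' => //=.
- by move=> b s s'; have [_] := inc _ _ s s' (leqnn _) (leqnSn _); apply.
Qed.

(** The entries in column j and rows a, ..., a + k - 1. *)
Definition segment (D : pred box) (f : box -> nat) (j a k : nat) : seq nat :=
  [seq f (j, i) | i <- iota a k & D (j, i)].

Definition reading (D : pred box) (f : box -> nat) (M N : nat) : seq nat :=
  word [seq segment D f j 0 N | j <- iota 0 M].

Lemma segment_eq (D D' : pred box) (f f' : box -> nat) j a k :
  (forall i, a <= i < a + k -> D (j, i) = D' (j, i)) ->
  (forall i, a <= i < a + k -> D (j, i) -> f (j, i) = f' (j, i)) ->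
  segment D f j a k = segment D' f' j a k.
Proof.
move=> eD ef; rewrite /segment.
have -> : [seq i <- iota a k | D' (j, i)] = [seq i <- iota a k | D (j, i)].
  by apply: eq_in_filter => i; rewrite mem_iota => /eD ->.
by apply/eq_in_map => i; rewrite mem_filter mem_iota => /andP[Di /ef ->].
Qed.

Lemma reading_eq (D D' : pred box) (f f' : box -> nat) M N :
  D =1 D' -> (forall b, D b -> f b = f' b) -> reading D f M N = reading D' f' M N.
Proof.
by move=> eD ef; congr word; apply: eq_map => j; apply: segment_eq => i _ => [|/ef].
Qed.

Lemma segment_split D f j a k l :
  segment D f j a (k + l) = segment D f j a k ++ segment D f j (a + k) l.
Proof. by rewrite /segment iotaD filter_cat map_cat. Qed.

Lemma segment1 D f j a k :
  segment D f j a k.+1 = (if D (j, a) then [:: f (j, a)] else [::]) ++ segment D f j a.+1 k.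
Proof. by rewrite /segment /=; case: ifP. Qed.

Lemma segment_at D f j i N : i < N ->
  segment D f j 0 N = segment D f j 0 i ++
    (if D (j, i) then [:: f (j, i)] else [::]) ++ segment D f j i.+1 (N - i.+1).
Proof.
move=> iN; rewrite -{1}(subnKC (ltnW iN)) segment_split add0n; congr cat.
by rewrite -segment1 subnSK.
Qed.

Lemma segment_col D f j a k : increasing D f -> col (segment D f j a k).
Proof.
move=> inc; apply: (@homo_sorted_in _ _ (fun i => D (j, i)) (fun i => f (j, i)) ltn).
- by move=> i i' Di Di' lt; have [_] := inc _ _ Di Di' (leqnn _) (ltnW lt); apply.
- exact: filter_all.
- by apply: sorted_filter; [exact: ltn_trans | exact: iota_ltn_sorted].
Qed.

Lemma segment_mem D f j a k v : v \in segment D f j a k ->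
  exists i, [/\ a <= i < a + k, D (j, i) & v = f (j, i)].
Proof.
by case/mapP => i; rewrite mem_filter mem_iota => /andP[Di ri] ->; exists i.
Qed.

Lemma segment_count p D f j a k :
  count p (segment D f j a k) = count (fun i => D (j, i) && p (f (j, i))) (iota a k).
Proof.
by rewrite /segment count_map count_filter; apply: eq_count => i /=; rewrite andbC.
Qed.

Lemma leq_count_in (T : eqType) (p q : pred T) (s : seq T) :
  {in s, forall x, p x -> q x} -> count p s <= count q s.
Proof.
elim: s => //= x s IH h; apply: leq_add; last by apply: IH => y ys; apply: h; rewrite inE ys orbT.
by have := h x (mem_head _ _); case: (p x) => // ->.
Qed.

Lemma reading_split D f M N j : j < M -> reading D f M N =
  word [seq segment D f k 0 N | k <- iota 0 j] ++ rev (segment D f j 0 N) ++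
  word [seq segment D f k 0 N | k <- iota j.+1 (M - j.+1)].
Proof.
move=> jM; rewrite /reading.
have -> : iota 0 M = iota 0 j ++ j :: iota j.+1 (M - j.+1).
  by rewrite -{1}(subnKC (ltnW jM)) iotaD add0n -(subnSK jM).
by rewrite map_cat word_cat.
Qed.

(** The skew tableau S in which the inside corner c has become a hole: the
    domain D of the fillings is the skew diagram together with c, so that D
    does not change while the hole moves. *)
Section Slide.
Variables (n : nat) (S : Defs.skew) (c : box) (M N : nat).
Hypotheses (po : is_partition (outer S)) (pi : is_partition (inner S)).
Hypothesis cc : inside_corner S c.
Hypotheses (hM : head 0 (outer S) <= M) (hN : size (outer S) <= N).

Let S1 := Skew (outer S) (remove_box (inner S) c) (filling S).
Let D : pred box := in_skew S1.
Let minus (h : box) : pred box := fun b => D b && (b != h).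

Let ci : in_diagram (inner S) c. Proof. by case/and3P: cc. Qed.
Let cr : ~~ in_diagram (inner S) (right_of c). Proof. by case/and3P: cc. Qed.
Let cb : ~~ in_diagram (inner S) (below c). Proof. by case/and3P: cc. Qed.

Let in_skewE b : in_skew S b = minus c b.
Proof.
rewrite /minus /D /in_skew /= diagram_remove // negb_and negbK.
by case: eqP => [->|_]; rewrite ?orbF ?andbF ?andbT // ci andbF.
Qed.

Let pi1 : is_partition (inner S1). Proof. exact: remove_part. Qed.

Let Dconvex b b' x : D b -> D b' -> b.1 <= x.1 -> b.2 <= x.2 ->
  x.1 <= b'.1 -> x.2 <= b'.2 -> D x.
Proof. exact: skew_convex. Qed.

Let DMN b : D b -> b.1 < M /\ b.2 < N.
Proof.
move=> /andP[ob _]; split.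
  by apply: leq_trans hM; apply: diagram_head ob.
by apply: leq_trans hN; apply: diagram_size ob.
Qed.

Definition hole_ok (f : box -> nat) (h : box) :=
  [/\ D h, c.1 <= h.1 /\ c.2 <= h.2, increasing (minus h) f & in_range n (minus h) f].

Let right_in h b : D h -> D b -> h.1 < b.1 -> h.2 <= b.2 -> D (right_of h).
Proof. by move=> Dh Db l1 l2; apply: Dconvex Dh Db _ _ _ _ => //=. Qed.

Let below_in h b : D h -> D b -> h.1 <= b.1 -> h.2 < b.2 -> D (below h).
Proof. by move=> Dh Db l1 l2; apply: Dconvex Dh Db _ _ _ _ => //=. Qed.

Let skew_right h : c.1 <= h.1 -> in_skew S (right_of h) = D (right_of h).
Proof.
move=> le; rewrite in_skewE /minus; case: eqP => [e|_]; last by rewrite andbT.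
by move: le; rewrite -e ltnn.
Qed.

Let skew_below h : c.2 <= h.2 -> in_skew S (below h) = D (below h).
Proof.
move=> le; rewrite in_skewE /minus; case: eqP => [e|_]; last by rewrite andbT.
by move: le; rewrite -e ltnn.
Qed.

Let minusP h b : minus h b -> D b /\ b != h. Proof. by move/andP. Qed.

Let minusI h b : D b -> b != h -> minus h b. Proof. by move=> Db nb; apply/andP. Qed.

(** The entry that moves up stays below the entries of its new row to the right
    because it is at most the right neighbour of the hole. *)
Lemma hole_ok_below f h : hole_ok f h -> D (below h) ->
  (D (right_of h) -> f (below h) <= f (right_of h)) ->
  hole_ok [eta f with h |-> f (below h)] (below h).
Proof.
case: h => j i [Dh [c1 c2] inc rg]; rewrite /below /right_of /= => Db le.
have mb : minus (j, i) (j, i.+1) by apply: minusI; rewrite // xpair_eqE; clear; lia.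
have mr b : D b -> j < b.1 -> i <= b.2 -> minus (j, i) (j.+1, i).
  move=> Db' l1 l2; apply: minusI; first exact: (right_in Dh Db').
  by rewrite xpair_eqE; clear; lia.
split=> //=; first by rewrite (leq_trans c2).
- move=> b b' /minusP[Db1 nb1] /minusP[Db2 nb2] l1 l2 /=.
  case: eqP => [e|ne]; case: eqP => [e'|ne'].
  + by rewrite e e' ltnn.
  + rewrite e /= in l1 l2 *.
    have mb' : minus (j, i) b' by apply: minusI => //; apply/eqP.
    have [l1'|l1'] : j = b'.1 \/ j < b'.1 by move: l1; clear; lia.
      have l2' : i.+1 <= b'.2.
        rewrite ltn_neqAle l2 andbT; apply/eqP => e2; apply: ne'.
        by rewrite -[b']box_eta -l1' -e2.
      have l2'' : i.+1 < b'.2.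
        rewrite ltn_neqAle l2' andbT; apply/eqP => e2; move/eqP: nb2; apply.
        by rewrite -[b']box_eta -l1' -e2.
      by have := inc _ _ mb mb' l1 l2'; move=> [_ /(_ l2'')]; clear; lia.
    have mr' := mr _ Db2 l1' l2.
    have le' : f (j, i.+1) <= f (j.+1, i) by apply: le; have [] := minusP mr'.
    have := inc _ _ mr' mb' l1' l2; move: le'; clear; move=> /= ? []; lia.
  + rewrite e' /= in l1 l2 *.
    have mb' : minus (j, i) b by apply: minusI => //; apply/eqP.
    have := inc _ _ mb' mb l1 (leqW l2); rewrite /= ltnS l2 => -[_ /(_ isT)].
    by clear; lia.
  + by apply: inc => //; apply: minusI => //; apply/eqP.
- move=> b /minusP[Db1 nb1] /=; case: eqP => [e|ne]; first exact: rg.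
  by apply: rg; apply: minusI => //; apply/eqP.
Qed.

Lemma hole_ok_right f h : hole_ok f h -> D (right_of h) ->
  (D (below h) -> f (right_of h) < f (below h)) ->
  hole_ok [eta f with h |-> f (right_of h)] (right_of h).
Proof.
case: h => j i [Dh [c1 c2] inc rg]; rewrite /below /right_of /= => Dr lt.
have mr : minus (j, i) (j.+1, i) by apply: minusI; rewrite // xpair_eqE; clear; lia.
have mb b : D b -> j <= b.1 -> i < b.2 -> minus (j, i) (j, i.+1).
  move=> Db' l1 l2; apply: minusI; first exact: (below_in Dh Db').
  by rewrite xpair_eqE; clear; lia.
split=> //=; first by rewrite (leq_trans c1).
- move=> b b' /minusP[Db1 nb1] /minusP[Db2 nb2] l1 l2 /=.
  case: eqP => [e|ne]; case: eqP => [e'|ne'].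
  + by rewrite e e' ltnn.
  + rewrite e /= in l1 l2 *.
    have mb' : minus (j, i) b' by apply: minusI => //; apply/eqP.
    have [l1'|l1'] : j = b'.1 \/ j < b'.1 by move: l1; clear; lia.
      have l2' : i.+1 <= b'.2.
        rewrite ltn_neqAle l2 andbT; apply/eqP => e2; apply: ne'.
        by rewrite -[b']box_eta -l1' -e2.
      have mbl := mb _ Db2 l1 l2'.
      have lt' : f (j.+1, i) < f (j, i.+1) by apply: lt; have [] := minusP mbl.
      have [+ _] := inc _ _ mbl mb' l1 l2'; move: lt'; clear; lia.
    by have := inc _ _ mr mb' l1' l2; apply.
  + rewrite e' /= in l1 l2 *.
    have mb' : minus (j, i) b by apply: minusI => //; apply/eqP.
    exact: inc _ _ mb' mr (leqW l1) l2.
  + by apply: inc => //; apply: minusI => //; apply/eqP.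
- move=> b /minusP[Db1 nb1] /=; case: eqP => [e|ne]; first exact: rg.
  by apply: rg; apply: minusI => //; apply/eqP.
Qed.

Lemma reading_below f j i : D (j, i) -> D (j, i.+1) ->
  reading (minus (j, i)) f M N =
  reading (minus (j, i.+1)) [eta f with (j, i) |-> f (j, i.+1)] M N.
Proof.
move=> Dh Db; congr word; apply: eq_map => k.
case: (eqVneq k j) => [->|nk]; last first.
  apply: segment_eq => l _; rewrite /minus /= !xpair_eqE (negPf nk) //.
have iN : i < N by have [] := DMN Dh.
have iN' : i.+1 < N by have [] := DMN Db.
rewrite !(segment_at _ _ _ iN) -(subnSK iN') !segment1 /=.
rewrite /minus Dh Db !xpair_eqE !eqxx /=.
have -> : (i.+1 == i) = false by clear; lia.
have -> : (i == i.+1) = false by clear; lia.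
rewrite /=; congr (_ ++ _ :: _); apply: segment_eq => l rl;
  rewrite !xpair_eqE eqxx /= ?xpair_eqE ?eqxx /=.
- by have [-> ->] : (l == i) = false /\ (l == i.+1) = false by move: rl; clear; lia.
- by have -> : (l == i) = false by move: rl; clear; lia.
- by have [-> ->] : (l == i) = false /\ (l == i.+1) = false by move: rl; clear; lia.
- by have -> : (l == i) = false by move: rl; clear; lia.
Qed.

(** All columns but two are unchanged, and for these two the rows above and below
    the hole give the hypotheses of knuth_slide_right. *)
Lemma reading_right f h : hole_ok f h -> D (right_of h) ->
  (D (below h) -> f (right_of h) < f (below h)) ->
  knuth (reading (minus h) f M N)
    (reading (minus (right_of h)) [eta f with h |-> f (right_of h)] M N).
Proof.
case: h => j i [Dh [c1 c2] inc rg]; rewrite /below /right_of /= => Dr lt.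
have [jM iN] : j < M /\ i < N by have := DMN Dh.
have jM' : j.+1 < M by have [] := DMN Dr.
set g := [eta f with _ |-> _].
have other k : k != j -> k != j.+1 ->
    segment (minus (j, i)) f k 0 N = segment (minus (j.+1, i)) g k 0 N.
  move=> n1 n2; apply: segment_eq => l _; rewrite /minus /g /= !xpair_eqE (negPf n1) ?(negPf n2) //.
rewrite !(reading_split _ _ _ jM) -(subnSK jM') /= !word_cons.
have -> : [seq segment (minus (j, i)) f k 0 N | k <- iota 0 j] =
          [seq segment (minus (j.+1, i)) g k 0 N | k <- iota 0 j].
  apply/eq_in_map => k; rewrite mem_iota => r; apply: other; move: r; clear; lia.
have -> : [seq segment (minus (j, i)) f k 0 N | k <- iota j.+2 (M - j.+2)] =
          [seq segment (minus (j.+1, i)) g k 0 N | k <- iota j.+2 (M - j.+2)].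
  apply/eq_in_map => k; rewrite mem_iota => r; apply: other; move: r; clear; lia.
apply: knuth_catl; rewrite !catA; apply: knuth_catr.
rewrite !(segment_at _ _ _ iN).
set A := segment (minus (j, i)) f j 0 i; set Z := segment (minus (j, i)) f j i.+1 _.
set X := segment (minus (j, i)) f j.+1 0 i; set Y := segment (minus (j, i)) f j.+1 i.+1 _.
have eA : segment (minus (j.+1, i)) g j 0 i = A.
  apply: segment_eq => l r; rewrite /minus /g /= !xpair_eqE /= eqxx /=.
    by have [-> ->] : (l == i) = false /\ (j == j.+1) = false by move: r; clear; lia.
  by have -> : (l == i) = false by move: r; clear; lia.
have eZ : segment (minus (j.+1, i)) g j i.+1 (N - i.+1) = Z.
  apply: segment_eq => l r; rewrite /minus /g /= !xpair_eqE /= eqxx /=.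
    by have [-> ->] : (l == i) = false /\ (j == j.+1) = false by move: r; clear; lia.
  by have -> : (l == i) = false by move: r; clear; lia.
have jj : (j.+1 == j) = false by clear; lia.
have jj' : (j == j.+1) = false by clear; lia.
have eX : segment (minus (j.+1, i)) g j.+1 0 i = X.
  apply: segment_eq => l r; rewrite /minus /g /= !xpair_eqE /= eqxx jj //=.
  by have -> : (l == i) = false by move: r; clear; lia.
have eY : segment (minus (j.+1, i)) g j.+1 i.+1 (N - i.+1) = Y.
  apply: segment_eq => l r; rewrite /minus /g /= !xpair_eqE /= eqxx jj //=.
  by have -> : (l == i) = false by move: r; clear; lia.
rewrite eA eZ eX eY /minus Dh Dr !xpair_eqE !eqxx jj jj' /g /= !xpair_eqE !eqxx /=.
have mr : minus (j, i) (j.+1, i) by apply: minusI; rewrite // xpair_eqE jj.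
have memA v : v \in A -> exists2 l, l < i & minus (j, i) (j, l) /\ v = f (j, l).
  by case/segment_mem => l [/andP[_ li] Dl ->]; exists l.
have memZ v : v \in Z -> exists2 l, i < l & minus (j, i) (j, l) /\ v = f (j, l).
  by case/segment_mem => l [/andP[li _] Dl ->]; exists l.
apply: knuth_slide_right.
- exact: segment_col.
- exact: segment_col.
- have -> : X ++ f (j.+1, i) :: Y = segment (minus (j, i)) f j.+1 0 N.
    by rewrite (segment_at _ _ _ iN) mr.
  exact: segment_col.
- move=> t; rewrite !segment_count; apply: leq_count_in => l; rewrite mem_iota.
  move=> /andP[il _] /andP[Dl le].
  have [Dl' _] := minusP Dl.
  have Dl1 : D (j, l) by apply: Dconvex Dh Dl' _ _ _ _ => //=; apply: ltnW.
  have ml1 : minus (j, i) (j, l).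
    by apply: minusI; rewrite // xpair_eqE; move: il; clear; lia.
  have [+ _] := inc _ _ ml1 Dl (leqnSn _) (leqnn _).
  by rewrite ml1 /= => h; apply: leq_trans le.
- move=> t; rewrite !segment_count; apply: leq_count_in => l; rewrite mem_iota.
  move=> /andP[_ il] /andP[Dl le].
  have [Dl' _] := minusP Dl.
  have Dl1 : D (j.+1, l) by apply: Dconvex Dl' Dr _ _ _ _ => //=; apply: ltnW.
  have ml1 : minus (j, i) (j.+1, l) by apply: minusI; rewrite // xpair_eqE jj.
  have [+ _] := inc _ _ Dl ml1 (leqnSn _) (leqnn _).
  by rewrite ml1 /= => h; apply: leq_trans h.
- apply/allrelP => u v /memA[l li [ml ->]] /memZ[l' li' [ml' ->]].
  by have [_ /(_ (ltn_trans li li'))] := inc _ _ ml ml' (leqnn _) (ltnW (ltn_trans li li')).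
- apply/allP => v /memZ[l il [ml ->]] /=.
  have [Dl _] := minusP ml.
  have Db : D (j, i.+1) by apply: (below_in Dh Dl).
  have mb : minus (j, i) (j, i.+1) by apply: minusI; rewrite // xpair_eqE; clear; lia.
  have [h _] := inc _ _ mb ml (leqnn _) il.
  exact: leq_trans (lt Db) h.
- apply/allP => v /memA[l li [ml ->]] /=.
  by have [_ /(_ li)] := inc _ _ ml mr (leqnSn _) (ltnW li).
Qed.

(** Vertical moves do not change the reading word and horizontal moves change it
    within its Knuth class. *)
Lemma slide_knuth f h g e : slide S f h g e -> hole_ok f h ->
  hole_ok g e /\ ~~ D (right_of e) /\ ~~ D (below e) /\
  knuth (reading (minus h) f M N) (reading (minus e) g M N).
Proof.
elim=> {f h g e} [f h r b ok|f h g e b le _ IH ok|f h g e r lt _ IH ok].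
- have [_ [c1 c2] _ _] := ok.
  by rewrite -skew_right // -skew_below.
- have [Dh [c1 c2] _ _] := ok.
  rewrite skew_below // in b; rewrite skew_right // in le.
  have [ok' [-> [-> k]]] := IH (hole_ok_below ok b le); split=> //; do 2!split=> //.
  apply: knuth_trans k; case: h Dh b {ok le IH c1 c2} => j i Dh b.
  by rewrite reading_below.
- have [Dh [c1 c2] _ _] := ok.
  rewrite skew_right // in r; rewrite skew_below // in lt.
  have [ok' [-> [-> k]]] := IH (hole_ok_right ok r lt); split=> //; do 2!split=> //.
  apply: knuth_trans k; exact: reading_right.
Qed.

End Slide.

(** * Existence of slides and corners *)

Lemma word_filter cs : word [seq c <- cs | c != [::]] = word cs.
Proof. by elim: cs => //= c cs IH; case: eqP => [->|_]; rewrite ?word_cons IH. Qed.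

Lemma word_columns S M N : is_partition (outer S) -> head 0 (outer S) <= M ->
  size (outer S) <= N -> word (columns S) = reading (in_skew S) (filling S) M N.
Proof.
move=> po hM hN; rewrite /columns word_filter /reading.
rewrite -{1}(subnKC hM) iotaD map_cat word_cat add0n.
have -> : word [seq segment (in_skew S) (filling S) j 0 N
                 | j <- iota (head 0 (outer S)) (M - head 0 (outer S))] = [::].
  rewrite (_ : [seq _ | j <- _] = [seq [::] | j <- iota (head 0 (outer S)) 
    (M - head 0 (outer S))]).
    by elim: (iota _ _).
  apply/eq_in_map => j; rewrite mem_iota => /andP[hj _].
  rewrite /segment (@eq_filter _ _ pred0) ?filter_pred0 // => i.
  by apply/negP => /andP[/(diagram_head po)] /=; rewrite ltnNge hj.
rewrite cats0; congr word; apply: eq_map => j.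
rewrite -(subnKC hN) segment_split add0n -[LHS]cats0; congr cat.
case: (segment _ _ _ _ _) (@segment_mem (in_skew S) (filling S) j (size (outer S)) (N - size (outer S))) => // v s h.
have [i [/andP[r _] /andP[/diagram_size + _] _]] := h _ (mem_head _ _).
by rewrite /= ltnNge r.
Qed.

Lemma jdt_step_knuth n S S' : is_skew_tableau n S -> jdt_step S S' ->
  [/\ is_skew_tableau n S', knuth (word (columns S)) (word (columns S'))
    & sumn (inner S) = (sumn (inner S')).+1].
Proof.
move=> vS [c [e [g [ic sl ->]]]] {S'}.
have [[po pi sub] [rg _ _]] := vS; have inc := skew_increasing vS.
have [ci cr cb] := and3P ic.
pose S1 := Skew (outer S) (remove_box (inner S) c) (filling S).
have pi1 : is_partition (inner S1) by exact: remove_part.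
have eS : in_skew S =1 (fun b => in_skew S1 b && (b != c)).
  move=> b; rewrite /in_skew /= diagram_remove // negb_and negbK.
  by case: eqP => [->|_]; rewrite ?orbF ?andbF ?andbT // ci andbF.
have ok : hole_ok n S c (filling S) c.
  split => //.
  - by rewrite /in_skew /= diagram_remove // eqxx andbF sub.
  - by move=> b b' h h'; apply: inc; rewrite eS.
  - by move=> b h; apply: rg; rewrite eS.
have [[De _ inc' rg'] [nr [nb k]]] :=
  slide_knuth po pi ic (leqnn _) (leqnn _) sl ok.
have [oe nie] := andP De.
have out x : e.1 <= x.1 -> e.2 <= x.2 -> ~~ in_skew S1 x -> ~~ in_diagram (outer S) x.
  move=> l1 l2; rewrite negb_and negbK => /orP[//|h].
  by exfalso; move/negP: nie; apply; apply: diagram_mono h l1 l2.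
have or : ~~ in_diagram (outer S) (right_of e) by apply: out nr => //=.
have ob : ~~ in_diagram (outer S) (below e) by apply: out nb => //=.
set S' := Skew _ _ _.
have eS' : in_skew S' =1 (fun b => in_skew S1 b && (b != e)).
  by move=> b; rewrite /in_skew /= (diagram_remove _ oe) // andbAC.
have po' : is_partition (outer S') by exact: remove_part.
split.
- apply: increasing_skew => //.
  + move=> b ib; rewrite /= diagram_remove //; apply/andP; split.
      by apply: sub; move: ib; rewrite /= diagram_remove // => /andP[].
    by apply: contraNneq nie => <-.
  + by move=> b; rewrite eS' => h; apply: rg'.
  + by move=> b b'; rewrite !eS' => h h'; apply: inc'.
- rewrite (word_columns po (leqnn _) (leqnn _)).
  rewrite (@word_columns S' (head 0 (outer S)) (size (outer S)) po').
  + rewrite (reading_eq _ _ eS (fun _ _ => erefl)) (reading_eq _ _ eS' (fun _ _ => erefl)).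
    exact: k.
  + rewrite -!nth0 /= /remove_box nth_set_nth /=; case: eqP => // <-; clear; lia.
  + by rewrite /= size_remove.
- rewrite /= /remove_box; move: ci; rewrite /in_diagram.
  elim: (inner S) (c.2) => [|a s IH] [|i] //=; rewrite ?nth_nil //.
    by move: (c.1) => u; clear; lia.
  by move=> /IH ->; rewrite addnS.
Qed.

(** The end of the last nonempty row. *)
Lemma corner_exists mu b : is_partition mu -> in_diagram mu b ->
  exists c, forall S, inner S = mu -> inside_corner S c.
Proof.
move=> p db.
have ex : exists i, 0 < nth 0 mu i by exists b.2; apply: leq_ltn_trans db.
have ub i : 0 < nth 0 mu i -> i <= size mu.
  by move=> h; apply: ltnW; apply: (@diagram_size mu (0, i)).
pose i := ex_maxn ex ub.
have [hi mi] : 0 < nth 0 mu i /\ forall k, 0 < nth 0 mu k -> k <= i.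
  by rewrite /i; case: ex_maxnP.
exists ((nth 0 mu i).-1, i) => S eS; rewrite /inside_corner eS /in_diagram /=.
have -> : nth 0 mu i.+1 = 0.
  by apply/eqP; rewrite -leqn0 leqNgt; apply/negP => /mi; rewrite ltnn.
by move: hi; clear; lia.
Qed.

Lemma slide_exists S f h : is_partition (outer S) -> exists g e, slide S f h g e.
Proof.
move=> po.
have [m] := ubnP ((size (outer S) - h.2) + (head 0 (outer S) - h.1)).
elim: m f h => // m IH f h le.
have goB : in_skew S (below h) ->
    (size (outer S) - (below h).2) + (head 0 (outer S) - (below h).1) < m.
  by move=> /andP[/diagram_size /= + _]; move: le; clear; lia.
have goR : in_skew S (right_of h) ->
    (size (outer S) - (right_of h).2) + (head 0 (outer S) - (right_of h).1) < m.
  by move=> /andP[/(diagram_head po) /= + _]; move: le; clear; lia.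
case: (boolP (in_skew S (below h))) => b; case: (boolP (in_skew S (right_of h))) => r.
- case: (leqP (f (below h)) (f (right_of h))) => cmp.
    have [g [e s]] := IH [eta f with h |-> f (below h)] _ (goB b).
    by exists g, e; apply: slide_below s.
  have [g [e s]] := IH [eta f with h |-> f (right_of h)] _ (goR r).
  by exists g, e; apply: slide_right s.
- have [g [e s]] := IH [eta f with h |-> f (below h)] _ (goB b).
  by exists g, e; apply: slide_below s => //; rewrite (negPf r).
- have [g [e s]] := IH [eta f with h |-> f (right_of h)] _ (goR r).
  by exists g, e; apply: slide_right s => //; rewrite (negPf b).
- by exists f, h; apply: slide_stop.
Qed.

Lemma filter_down (p : pred nat) N : (forall i, p i.+1 -> p i) ->
  [seq i <- iota 0 N | p i] = iota 0 (count p (iota 0 N)).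
Proof.
move=> dn; have dn' i k : p (i + k) -> p i.
  by elim: k => [|k IH]; rewrite ?addn0 // addnS => /dn.
elim: N => // N IH; rewrite -addn1 iotaD filter_cat count_cat IH add0n /=.
case: (boolP (p N)) => pN /=; last by rewrite cats0 !addn0.
rewrite addn0 iotaD /= add0n; congr (_ ++ [:: _]).
rewrite (_ : count p _ = N) // -[RHS](size_iota 0); apply/eqP; rewrite -all_count.
by apply/allP => i; rewrite mem_iota add0n => /andP[_ /ltnW iN]; apply: (dn' i (N - i)); rewrite subnKC.
Qed.

Lemma segment_diagram mu f j N : is_partition mu -> size mu <= N ->
  let s := segment (in_diagram mu) f j 0 N in
  (forall i, (i < size s) = in_diagram mu (j, i)) /\
  (forall i, in_diagram mu (j, i) -> nth 0 s i = f (j, i)).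
Proof.
move=> p hN s.
have dn i : in_diagram mu (j, i.+1) -> in_diagram mu (j, i).
  by move=> h; apply: diagram_mono h _ _ => //=.
have es : s = [seq f (j, i) | i <- iota 0 (count (fun i => in_diagram mu (j, i)) (iota 0 N))].
  by rewrite /s /segment filter_down.
have zs i : (i < size s) = in_diagram mu (j, i).
  have -> : (i < size s) = (i \in [seq i <- iota 0 N | in_diagram mu (j, i)]).
    by rewrite filter_down // mem_iota es size_map size_iota.
  rewrite mem_filter mem_iota /=; case: (boolP (in_diagram mu (j, i))) => //= h.
  by apply: leq_trans hN; apply: (diagram_size h).
split=> // i; rewrite -zs es size_map size_iota => lt.
by rewrite (nth_map 0) ?size_iota // nth_iota.
Qed.

Lemma straight_diagram mu f a k N : is_partition mu -> increasing (in_diagram mu) f ->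
  straight [seq segment (in_diagram mu) f j 0 N | j <- iota a k].
Proof.
move=> p inc; elim: k a => //= k IH a; split; first exact: segment_col.
split; last exact: IH.
case: k {IH} => [|k] //= t; rewrite !segment_count; apply: leq_count_in => i _ /andP[d le].
have d' : in_diagram mu (a, i) by apply: diagram_mono d _ _ => //=.
by have [h _] := inc _ _ d' d (leqnSn _) (leqnn _); rewrite d' (leq_trans h).
Qed.

(** * Skew tableaux and lists of columns *)

Lemma in_skew_of T b : in_skew (skew_of T) b = in_diagram (shape T) b.
Proof. by rewrite /in_skew /= /in_diagram nth_nil ltn0 andbT. Qed.

Lemma no_corner_inner S : is_partition (inner S) -> (forall c, ~~ inside_corner S c) ->
  forall b, in_diagram (inner S) b = false.
Proof.
move=> pi nc b; apply/negP => /(corner_exists pi)[c /(_ S erefl)]; exact/negP.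
Qed.

Lemma rectifies_word n T S : rectifies_to T S -> is_skew_tableau n S ->
  is_tableau n (shape T) T /\ knuth (word (columns S)) (word (columns (skew_of T))).
Proof.
elim=> {S} [S nc eo ef|S S' st _ IH] vS; last first.
  have [vS' k _] := jdt_step_knuth vS st; have [vT k'] := IH vS'.
  by split=> //; apply: knuth_trans k'.
have [[po pi sub] [rg _ _]] := vS; have inc := skew_increasing vS.
have ni := no_corner_inner pi nc.
have eD b : in_skew S b = in_skew (skew_of T) b.
  by rewrite in_skew_of /in_skew ni andbT /in_diagram eo.
have ed b : in_skew S b -> filling S b = filling (skew_of T) b.
  by rewrite eD in_skew_of => /ef.
have pT : is_partition (shape T).
  by apply/is_partP => i; rewrite -!eo; move: i; apply/is_partP.
split; [split=> //|].
  apply: increasing_skew => //=.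
  - by move=> b; rewrite /in_diagram nth_nil.
  - by move=> b; rewrite -eD => sb; rewrite -[entry T]/(filling (skew_of T)) -ed // rg.
  - move=> b b'; rewrite -!eD => sb sb' l1 l2.
    by rewrite -[entry T]/(filling (skew_of T)) -!ed //; apply: inc.
pose M := maxn (head 0 (outer S)) (head 0 (shape T)).
pose N := maxn (size (outer S)) (size (shape T)).
rewrite (@word_columns S M N) ?leq_maxl // (@word_columns (skew_of T) M N) ?leq_maxr //.
by rewrite (reading_eq _ _ eD ed).
Qed.

(** Slides can be performed as long as the inner shape is not empty; the tableau
    obtained in the end is T by uniqueness in the Knuth class. *)
Lemma rectifies_intro n T S : is_tableau n (shape T) T -> is_skew_tableau n S ->
  knuth (word (columns S)) (word (columns (skew_of T))) -> rectifies_to T S.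
Proof.
move=> [_ vT]; have [m] := ubnP (sumn (inner S)); elim: m S => // m IH S lem vS k.
have [[po pi sub] _] := vS.
case: (boolP (has (leq 1) (inner S))) => [/(has_nthP 0)[i _ hi]|/hasPn z].
  have [c /(_ S erefl) ic] := @corner_exists (inner S) (0, i) pi hi.
  have [g [e s]] := slide_exists (filling S) c po.
  have st : jdt_step S (Skew (remove_box (outer S) e) (remove_box (inner S) c) g).
    by exists c, e, g.
  have [vS' k' es] := jdt_step_knuth vS st.
  apply: rectifies_step st _; apply: IH => //; first by move: lem; rewrite es.
  by apply: knuth_trans k; apply: knuth_sym.
have ni b : in_diagram (inner S) b = false.
  apply/negP => db; have := diagram_size db => /(mem_nth 0) /z.
  by rewrite -ltnNge ltnS leqn0 => /eqP e; move: db; rewrite /in_diagram e.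
have [[pT _ _] _] := vT.
pose M := maxn (head 0 (outer S)) (head 0 (shape T)).
pose N := maxn (size (outer S)) (size (shape T)).
have eS : in_skew S =1 in_diagram (outer S) by move=> b; rewrite /in_skew ni andbT.
have eT : in_skew (skew_of T) =1 in_diagram (shape T) by move=> b; rewrite in_skew_of.
have iS : increasing (in_diagram (outer S)) (filling S).
  by move=> b b'; rewrite -!eS; apply: skew_increasing vS _ _.
have iT : increasing (in_diagram (shape T)) (entry T).
  by move=> b b'; rewrite -!eT; apply: skew_increasing vT _ _.
move: k; rewrite (@word_columns S M N) ?leq_maxl // (@word_columns (skew_of T) M N) ?leq_maxr //.
rewrite (reading_eq _ _ eS (fun _ _ => erefl)) (reading_eq _ _ eT (fun _ _ => erefl)).
move/straight_unique => /(_ (straight_diagram _ _ _ po iS) (straight_diagram _ _ _ pT iT)).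
rewrite !size_map => /(_ erefl) /eq_in_map ecol.
have hN1 : size (outer S) <= N by exact: leq_maxl.
have hN2 : size (shape T) <= N by exact: leq_maxr.
have ediag j i : in_diagram (outer S) (j, i) = in_diagram (shape T) (j, i).
  case: (ltnP j M) => jM.
    have e := ecol j; rewrite mem_iota /= jM in e.
    have [h1 _] := segment_diagram (filling S) j po hN1.
    have [h2 _] := segment_diagram (entry T) j pT hN2.
    by rewrite -h1 -h2 e.
  transitivity false; last symmetry; apply/negP.
    by move/(diagram_head po) => /=; move: jM; rewrite /M; clear; lia.
  by move/(diagram_head pT) => /=; move: jM; rewrite /M; clear; lia.
apply: rectifies_done.
- by move=> c; apply/negP => /and3P[]; rewrite ni.
- move=> i; apply/eqP; rewrite eqn_leq; apply/andP; split; rewrite leqNgt; apply/negP => lt.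
    by have := ediag (nth 0 (shape T) i) i; rewrite /in_diagram /= lt ltnn.
  by have := ediag (nth 0 (outer S) i) i; rewrite /in_diagram /= lt ltnn.
- move=> [j i] d; have jM : j < M by have := diagram_head pT d; rewrite /= /M; clear; lia.
  have e := ecol j; rewrite mem_iota /= jM in e.
  have [_ h1] := segment_diagram (filling S) j po hN1.
  have [_ h2] := segment_diagram (entry T) j pT hN2.
  by rewrite -h2 // -h1 ?ediag // e.
Qed.

Lemma skew_columns n S : is_skew_tableau n S ->
  cols (columns S) /\ all (fun c => c != [::]) (columns S).
Proof.
move=> /skew_increasing inc; split; last exact: filter_all.
apply/allP => c; rewrite mem_filter => /andP[_ /mapP[j _ ->]].
exact: (@segment_col (in_skew S) (filling S) j 0).
Qed.

Lemma tableau_columns n T : is_tableau n (shape T) T ->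
  [/\ columns (skew_of T) = [seq column (skew_of T) j | j <- iota 0 (head 0 (shape T))],
      straight (columns (skew_of T)) & sizes (columns (skew_of T)) = column_lengths (shape T)].
Proof.
move=> [_ vT]; have [[pT _ _] _] := vT.
have eT : in_skew (skew_of T) =1 in_diagram (shape T) by move=> b; rewrite in_skew_of.
have iT : increasing (in_diagram (shape T)) (entry T).
  by move=> b b'; rewrite -!eT; apply: skew_increasing vT _ _.
have ec j : column (skew_of T) j = segment (in_diagram (shape T)) (entry T) j 0 (size (shape T)).
  by apply: segment_eq => i _.
have e : columns (skew_of T) = [seq column (skew_of T) j | j <- iota 0 (head 0 (shape T))].
  apply/all_filterP/allP => c /mapP[j]; rewrite mem_iota /= => jh ->.
  have [h _] := segment_diagram (entry T) j pT (leqnn _).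
  by rewrite ec -size_eq0 -lt0n h /in_diagram /= nth0.
split=> //.
  rewrite e; rewrite (eq_map ec); exact: straight_diagram.
rewrite e /sizes -map_comp; apply: eq_map => j /=.
rewrite ec /segment size_map size_filter.
by rewrite -[in RHS](mkseq_nth 0 (shape T)) /mkseq [in RHS]count_map.
Qed.

Lemma straight_pad cs k : straight cs -> straight (cs ++ nseq k [::]).
Proof.
elim: cs => [_|c cs IH] /=; first by elim: k => //= k IH; split=> //; split=> //; case: k {IH}.
move=> [cc [s sc]]; split=> //; split; last exact: IH.
by case: cs s {IH sc} => //=; case: k.
Qed.

Lemma word_pad cs k : word (cs ++ nseq k [::]) = word cs.
Proof. by rewrite word_cat (_ : word (nseq k [::]) = [::]) ?cats0 //; elim: k. Qed.

Lemma straight_unique_nonempty cs ds : straight cs -> straight ds ->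
  all (fun c => c != [::]) cs -> all (fun c => c != [::]) ds ->
  knuth (word cs) (word ds) -> cs = ds.
Proof.
move=> scs sds ncs nds k.
have e : cs ++ nseq (size ds) [::] = ds ++ nseq (size cs) [::].
  apply: straight_unique; try exact: straight_pad.
    by rewrite !size_cat !size_nseq addnC.
  by rewrite !word_pad.
have f bs m : all (fun c => c != [::]) bs ->
    [seq c <- bs ++ nseq m [::] | c != [::] :> seq nat] = bs.
  move=> /all_filterP h; rewrite filter_cat h (_ : filter _ (nseq _ _) = [::]) ?cats0 //.
  by elim: m.
by rewrite -(f cs (size ds)) // e f.
Qed.

(** A disconnected skew diagram, with every column below and to the left of the
    following ones, so that no condition relates different columns. *)
Fixpoint antidiagonal (cs : seq (seq nat)) : Defs.skew :=
  if cs is c :: cs' then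
    let S := antidiagonal cs' in
    Skew ([seq l.+1 | l <- outer S] ++ nseq (size c) 1)
         ([seq l.+1 | l <- inner S] ++ nseq (size c) 0)
         (fun b => if b.1 is j.+1 then filling S (j, b.2)
                   else nth 0 c (b.2 - size (outer S)))
  else Skew [::] [::] (fun=> 0).

Lemma antidiagonal_ok n cs : cols cs -> all (fun c => c != [::]) cs ->
  all (all (fun v => 1 <= v <= n)) cs ->
  [/\ is_skew_tableau n (antidiagonal cs), columns (antidiagonal cs) = cs,
      size (inner (antidiagonal cs)) = size (outer (antidiagonal cs))
    & head 0 (outer (antidiagonal cs)) = size cs].
Proof.
elim: cs => [|c cs IH] /=.
  by split=> //; split; split=> // b; rewrite /in_skew /in_diagram nth_nil.
move=> /andP[cc ccs] /andP[nc ncs] /andP[rc rcs].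
have [vS eC sz hd] := IH ccs ncs rcs.
set S := antidiagonal cs in vS eC sz hd *; set S' := Skew _ _ _.
have [[po pi sub] [rg row colm]] := vS.
have nthc (s : seq nat) a i : nth 0 ([seq l.+1 | l <- s] ++ nseq (size c) a) i =
    if i < size s then (nth 0 s i).+1 else if i < size s + size c then a else 0.
  rewrite nth_cat size_map; case: ltnP => h; first by rewrite (nth_map 0).
  by rewrite nth_nseq ltn_subLR.
have out i : size (outer S) <= i -> nth 0 (outer S) i = 0 by move=> h; rewrite nth_default.
have inn i : size (outer S) <= i -> nth 0 (inner S) i = 0 by move=> h; rewrite nth_default ?sz.
have in0 i : in_skew S' (0, i) = (size (outer S) <= i < size (outer S) + size c).
  rewrite /in_skew /in_diagram /= !nthc sz; case: (ltnP i (size (outer S))) => //= _; by case: ifP.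
have inS j i : in_skew S' (j.+1, i) = in_skew S (j, i).
  rewrite /in_skew /in_diagram /= !nthc sz; case: (ltnP i (size (outer S))) => h //=; rewrite out //.
  by case: ifP.
have hd' : head 0 (outer S') = (size cs).+1.
  rewrite /=; case: (outer S) hd => [|a s] /= <- //.
  by case: (c) nc.
have cS' : is_skew_tableau n S'.
  split; split.
  - apply/is_partP => i; rewrite /= !nthc; move/is_partP: po => /(_ i); clear.
    case: (ltnP i.+1 (size (outer S))) => ?; case: (ltnP i (size (outer S))) => ?;
    case: (ltnP i.+1 (size (outer S) + size c)) => ?;
    case: (ltnP i (size (outer S) + size c)) => ?; lia.
  - apply/is_partP => i; rewrite /= !nthc sz; move/is_partP: pi => /(_ i); clear.
    case: (ltnP i.+1 (size (outer S))) => ?; case: (ltnP i (size (outer S))) => ?;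
    case: (ltnP i.+1 (size (outer S) + size c)) => ?;
    case: (ltnP i (size (outer S) + size c)) => ?; lia.
  - move=> [[|j] i]; rewrite /in_diagram /= !nthc sz; case: (ltnP i (size (outer S))) => h.
    + by [].
    + by case: ifP.
    + by rewrite !ltnS; apply: (sub (j, i)).
    + by case: ifP.
  - move=> [[|j] i]; last by rewrite inS => /rg.
    rewrite in0 => /andP[h1 h2] /=; apply: (allP rc); apply: mem_nth.
    by rewrite ltn_subLR.
  - move=> [[|j] i]; rewrite /right_of /=; last by rewrite !inS; apply: row.
    rewrite in0 inS => /andP[h _] /andP[+ _].
    by rewrite /in_diagram /= out.
  - move=> [[|j] i]; rewrite /below /=; last by rewrite !inS; apply: colm.
    rewrite !in0 => /andP[h1 _] /andP[_ h2]; rewrite subSn //.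
    by apply: (sortedP 0 cc); move: h1 h2; clear; lia.
split=> //; last by rewrite !size_cat !size_map !size_nseq sz.
have col0 : column S' 0 = c.
  rewrite -[column S' 0]/(segment (in_skew S') (filling S') 0 0 (size (outer S'))).
  rewrite [size _]/= size_cat size_map size_nseq segment_split add0n.
  have -> : segment (in_skew S') (filling S') 0 0 (size (outer S)) = [::].
    rewrite /segment (@eq_in_filter _ _ pred0) ?filter_pred0 // => i.
    by rewrite mem_iota in0 add0n => /andP[_ h]; rewrite leqNgt h.
  rewrite /segment (@eq_in_filter _ _ predT) ?filter_predT; last first.
    by move=> i; rewrite mem_iota in0 => ->.
  apply: (@eq_from_nth _ 0); rewrite size_map size_iota // => i ic.
  by rewrite (nth_map 0) ?size_iota // nth_iota //= addKn.
have colS j : column S' j.+1 = column S j.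
  rewrite -[LHS]/(segment (in_skew S') (filling S') j.+1 0 (size (outer S'))).
  rewrite [size _]/= size_cat size_map size_nseq segment_split add0n.
  rewrite [X in _ ++ X](_ : _ = [::]) ?cats0.
    by rewrite /segment /column (@eq_filter _ _ (fun i => in_skew S (j, i))).
  rewrite /segment (@eq_in_filter _ _ pred0) ?filter_pred0 // => i.
  by rewrite mem_iota inS /in_skew /in_diagram /= => /andP[/out -> _].
rewrite /columns hd' [iota _ _]/= [map _ _]/= col0 [filter _ _]/= nc.
rewrite -[1]addn0 iotaDl -map_comp (eq_map (g := column S)); last by move=> j /=; rewrite colS.
by rewrite -hd; congr cons.
Qed.

(** * Frank skew tableaux with a given last column *)

Lemma frank_witness_last n T S k : is_tableau n (shape T) T ->
  frank_witness n T k S -> 0 < k ->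
  let t := columns (skew_of T) in
  let B := drop (count (fun c => k < size c) t) t in
  [/\ col (rightmost_column S), size (rightmost_column S) = k, size (head [::] B) = k
    & exists Q, knuth (word (rcons Q (rightmost_column S))) (word B)].
Proof.
move=> vT [vS [T' rT' pT'] rT zk] k0 t B.
have [_ kST] := rectifies_word rT vS.
have [vT' kST'] := rectifies_word rT' vS.
have [_ st zt] := tableau_columns vT; have [_ st' zt'] := tableau_columns vT'.
have [cS nS] := skew_columns vS.
have [_ nt] := skew_columns (proj2 vT); have [_ nt'] := skew_columns (proj2 vT').
have e : columns (skew_of T') = columns (skew_of T).
  apply: straight_unique_nonempty => //; apply: knuth_trans kST; exact: knuth_sym.
rewrite -zt' e in pT'.
rewrite /rightmost_column in zk *; case/lastP: (columns S) cS pT' kST zk => [|Q C] cS pT' kST.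
  by move=> h; rewrite -h in k0.
rewrite last_rcons => zk.
have fS : frank_cols (rcons Q C) by split=> //; exists (columns (skew_of T)); split=> //;
  have := perm_size pT'; rewrite /sizes !size_map.
have zT : size t = (size Q).+1.
  by have := perm_size pT'; rewrite !size_map size_rcons.
have [Q2 kQ hd] := frank_last st zT fS kST; rewrite zk in kQ hd.
split; [by move: cS; rewrite all_rcons => /andP[] | by [] | exact: hd | by exists Q2].
Qed.

Lemma mem_word cs v : (v \in word cs) = has (fun c => v \in c) cs.
Proof. by elim: cs => //= c cs IH; rewrite word_cons mem_cat mem_rev IH. Qed.

Lemma straight_drop j t : straight t -> straight (drop j t).
Proof.
by elim: t j => [|c t IH] j //; case: j => [|j] // [_ [_ st]]; apply: IH.
Qed.

(** Moving column j of T to the end gives a frank list of columns, and every list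
    of columns is that of a skew tableau. *)
Lemma frank_witness_exists n T j : is_tableau n (shape T) T ->
  j < size (columns (skew_of T)) ->
  exists S, frank_witness n T (size (nth [::] (columns (skew_of T)) j)) S.
Proof.
move=> vT; set t := columns _ => jt.
have [et st zt] := tableau_columns vT; have [_ nt] := skew_columns (proj2 vT).
have sB : straight (drop j t) by exact: straight_drop.
move: sB; rewrite (drop_nth [::]) // => /longest_column_last [Q [C [cQ cC kQ zC zQ]]].
pose cs := take j t ++ rcons Q C.
have et' : take j t ++ nth [::] t j :: drop j.+1 t = t by rewrite -drop_nth // cat_take_drop.
have kcs : knuth (word cs) (word t).
  by rewrite -{1}et' /cs !word_cat; apply: knuth_catl.
have pcs : perm_eq (sizes cs) (sizes t).
  rewrite -{1}et' /cs !sizes_cat perm_cat2l /sizes map_rcons [map _ Q]zQ zC /=.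
  by rewrite perm_rcons.
have ncs : all (fun c => c != [::]) cs.
  have h bs : all (fun c => c != [::]) bs = all (leq 1) (sizes bs).
    by rewrite all_map; apply: eq_all => c; rewrite /= lt0n size_eq0.
  by rewrite h (perm_all _ pcs) -h.
have ccs : cols cs.
  rewrite all_cat all_rcons cC cQ !andbT.
  by apply/allP => c /mem_take; apply: (allP (straight_cols st)).
have rcs : all (all (fun v => 1 <= v <= n)) cs.
  apply/allP => c cin; apply/allP => v vc.
  have : v \in word t.
    by rewrite -(perm_mem (knuth_perm kcs)) mem_word; apply/hasP; exists c.
  rewrite mem_word => /hasP[c']; rewrite /t et => /mapP[i _ ->].
  case/mapP => i'; rewrite mem_filter => /andP[s _] ->.
  by have [_ [_ [rg _ _]]] := vT; apply: rg.
have [vS eS _ _] := antidiagonal_ok ccs ncs rcs.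
have rS : rectifies_to T (antidiagonal cs) by apply: (rectifies_intro vT vS); rewrite eS.
exists (antidiagonal cs); split=> //.
  by exists T; rewrite // eS -zt.
by rewrite /rightmost_column eS /cs -rcons_cat last_rcons.
Qed.

(** Translates entrywise comparison of columns into comparison of counts. *)
Lemma leq_nth_count y s i : sorted leq s -> i < size s ->
  (y <= nth 0 s i) = (size s - i <= count (fun v => y <= v) s).
Proof.
elim: s i => // a s IH i srt.
have /andP[/allP as_ cs] : all (leq a) s && sorted leq s.
  by move: srt; rewrite /= path_sortedE //; apply: leq_trans.
have full : y <= a -> count (fun v => y <= v) s = size s.
  by move=> ya; apply/eqP; rewrite -all_count; apply/allP => v /as_; apply: leq_trans.
case: i => [|i] /=; last first.
  rewrite ltnS subSS => lt; case: (leqP y a) => ya; last exact: IH.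
  rewrite full // (leq_trans ya) ?as_ ?mem_nth //; symmetry; clear; lia.
move=> _; rewrite subn0; case: (leqP y a) => ya; first by rewrite full // leqnn.
by rewrite add0n ltnNge count_size.
Qed.

Lemma entries_le_count s u : sorted leq s -> sorted leq u -> size s = size u ->
  (forall i, i < size s -> nth 0 s i <= nth 0 u i) <->
  (forall y, count (fun v => y <= v) s <= count (fun v => y <= v) u).
Proof.
move=> ss su e; split=> [h y|h i lt]; last first.
  by rewrite leq_nth_count -?e //; apply: leq_trans (h _); rewrite -leq_nth_count.
case: (posnP (count (fun v => y <= v) s)) => [->//|pos].
have le := count_size (fun v => y <= v) s.
set m := count _ s in pos le *.
have lt : size s - m < size s by move: pos le; clear; lia.
have em : size s - (size s - m) = m by rewrite subKn.
have lt' : size s - m < size u by rewrite -e.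
have := leq_nth_count y su lt'; rewrite -e em => <-.
by apply: leq_trans (h _ lt); rewrite leq_nth_count // em.
Qed.

Definition of_columns (mu : seq nat) (C : nat -> seq nat) : seq (seq nat) :=
  [seq [seq nth 0 (C j) i | j <- iota 0 (nth 0 mu i)] | i <- iota 0 (size mu)].

Lemma shape_of_columns mu C : shape (of_columns mu C) = mu.
Proof.
rewrite /shape /of_columns -map_comp -[RHS](mkseq_nth 0); apply: eq_map => i /=.
by rewrite size_map size_iota.
Qed.

Lemma entry_of_columns mu C b : in_diagram mu b ->
  entry (of_columns mu C) b = nth 0 (C b.1) b.2.
Proof.
move=> db; have lt := diagram_size db; rewrite /entry /of_columns.
by rewrite (nth_map 0) ?size_iota // nth_iota // (nth_map 0) ?size_iota // nth_iota.
Qed.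

Lemma nth_column_lengths mu j : is_partition mu -> j < head 0 mu ->
  forall i, (i < nth 0 (column_lengths mu) j) = in_diagram mu (j, i).
Proof.
move=> p jh i; rewrite /column_lengths (nth_map 0) ?size_iota // nth_iota // add0n.
have [<- _] := segment_diagram (fun=> 0) j p (leqnn _).
rewrite /segment size_map size_filter -[in LHS](mkseq_nth 0 mu) /mkseq count_map.
by congr (_ < _); apply: eq_count.
Qed.

Lemma eq_of_ltn a b : (forall i, (i < a) = (i < b)) -> a = b.
Proof. by move=> h; apply/eqP; rewrite eqn_leq (leqNgt a) (leqNgt b) -h ltnn h ltnn. Qed.

Lemma column_of_columns mu C j : is_partition mu -> j < head 0 mu ->
  size (C j) = nth 0 (column_lengths mu) j -> column (skew_of (of_columns mu C)) j = C j.
Proof.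
move=> p jh zC; set K := of_columns mu C.
have -> : column (skew_of K) j = segment (in_diagram mu) (entry K) j 0 (size mu).
  rewrite /column /= shape_of_columns.
  by apply: segment_eq => i _; rewrite in_skew_of shape_of_columns.
have [h1 h2] := segment_diagram (entry K) j p (leqnn _).
apply: (@eq_from_nth _ 0).
  by apply: eq_of_ltn => i; rewrite h1 zC nth_column_lengths.
by move=> i; rewrite h1 => d; rewrite h2 // entry_of_columns.
Qed.

Lemma column_entry T j : is_partition (shape T) -> j < head 0 (shape T) ->
  size (column (skew_of T) j) = nth 0 (column_lengths (shape T)) j /\
  forall i, in_diagram (shape T) (j, i) -> nth 0 (column (skew_of T) j) i = entry T (j, i).
Proof.
move=> p jh.
have -> : column (skew_of T) j = segment (in_diagram (shape T)) (entry T) j 0 (size (shape T)).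
  by rewrite /column /=; apply: segment_eq => i _; rewrite in_skew_of.
have [h1 h2] := segment_diagram (entry T) j p (leqnn _); split=> //.
by apply: eq_of_ltn => i; rewrite h1 nth_column_lengths.
Qed.

Lemma count_lt_iota m n : count (fun i => i < m) (iota 0 n) = minn m n.
Proof.
elim: n => [|n IH]; first by rewrite minn0.
by rewrite -addn1 iotaD count_cat IH /= add0n; clear; lia.
Qed.

Lemma nth_staircase n d i : nth 0 (staircase n d) i = minn d (n - i).
Proof.
rewrite /staircase; case: (ltnP i n) => lt; first by rewrite nth_mkseq.
by rewrite nth_default ?size_mkseq //; move: lt; clear; lia.
Qed.

Lemma staircase_part n d : is_partition (staircase n d).
Proof. by apply/is_partP => i; rewrite !nth_staircase; clear; lia. Qed.

Lemma staircase_columns n d : d <= n ->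
  column_lengths (staircase n d) = [seq n - j | j <- iota 0 d].
Proof.
move=> dn; rewrite /column_lengths -nth0 nth_staircase subn0 (minn_idPl dn).
apply/eq_in_map => j; rewrite mem_iota add0n => /andP[_ jd].
rewrite /staircase /mkseq count_map -[RHS](minn_idPl (leq_subr j n)) -count_lt_iota.
by apply: eq_count => i /=; move: jd; clear; lia.
Qed.

Lemma one_rowed_size n (w : 'S_n) : size (one_rowed_form w) = n.
Proof. by rewrite size_map size_enum_ord. Qed.

Lemma one_rowed_nth n (w : 'S_n) (i : 'I_n) : nth 0 (one_rowed_form w) i = (w i).+1.
Proof. by rewrite (nth_map i) ?size_enum_ord // nth_ord_enum. Qed.

Lemma one_rowed_uniq n (w : 'S_n) : uniq (one_rowed_form w).
Proof.
by rewrite map_inj_uniq ?enum_uniq // => i j [/val_inj/perm_inj].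
Qed.

Lemma one_rowed_mem n (w : 'S_n) v : (v \in one_rowed_form w) = (0 < v <= n).
Proof.
apply/mapP/idP => [[i _ ->]|]; first by rewrite /= ltn_ord.
case: v => // v /= lt; exists (w^-1 (Ordinal lt))%g; first by rewrite mem_enum.
by rewrite permKV.
Qed.

Lemma one_rowed_avoids n (w : 'S_n) : avoids_312 w -> avoids (one_rowed_form w).
Proof.
move=> av a b c /andP[ab bc]; rewrite one_rowed_size => cn h.
have bn := ltn_trans bc cn; have an := ltn_trans ab bn.
apply: av; exists (Ordinal an), (Ordinal bn), (Ordinal cn); rewrite /= ab bc; split=> //.
move: h; rewrite -[a]/(val (Ordinal an)) -[b]/(val (Ordinal bn)) -[c]/(val (Ordinal cn)).
by rewrite !one_rowed_nth !ltnS.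
Qed.

(** * Right keys of tableaux of staircase shape *)

Lemma key_of_columns mu n (w : 'S_n) : key mu w =
  of_columns mu (fun j => sort leq (take (nth 0 (column_lengths mu) j) (one_rowed_form w))).
Proof. by []. Qed.

Section Staircase.
Variables (n d : nat) (w : 'S_n) (T : seq (seq nat)).
Hypothesis hd : 1 <= d <= n.
Hypothesis vT : is_tableau n (staircase n d) T.
Let mu := staircase n d.
Let x := one_rowed_form w.
Let t := columns (skew_of T).

Let eT : shape T = mu. Proof. by case: vT. Qed.
Let vT' : is_tableau n (shape T) T. Proof. by rewrite eT. Qed.
Let pT : is_partition (shape T). Proof. by rewrite eT; apply: staircase_part. Qed.
Let dn : d <= n. Proof. by case/andP: hd. Qed.
Let headT : head 0 (shape T) = d.
Proof. by rewrite eT -nth0 nth_staircase subn0; apply/minn_idPl. Qed.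

Let nth_len j : j < d -> nth 0 (column_lengths (shape T)) j = n - j.
Proof.
by move=> jd; rewrite eT staircase_columns // (nth_map 0) ?size_iota // nth_iota.
Qed.

Let size_t : size t = d.
Proof. by have [e _ _] := tableau_columns vT'; rewrite /t e size_map size_iota headT. Qed.

Let nth_t j : j < d -> nth [::] t j = column (skew_of T) j.
Proof.
move=> jd; have [e _ _] := tableau_columns vT'.
by rewrite /t e headT (nth_map 0) ?size_iota // nth_iota.
Qed.

Let size_nth_t j : j < d -> size (nth [::] t j) = n - j.
Proof.
move=> jd; rewrite nth_t //; have [-> _] := column_entry pT (eq_ind_r (fun m => j < m) jd headT).
by rewrite nth_len.
Qed.

Let col_t j : j < d -> col (nth [::] t j).
Proof.
move=> jd; have [_ st _] := tableau_columns vT'.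
by apply: (allP (straight_cols st)); rewrite mem_nth // size_t.
Qed.

Let count_t j : j < d -> count (fun c => n - j < size c) t = j.
Proof.
move=> jd; have [_ _ zt] := tableau_columns vT'.
rewrite -(count_map size (fun m => n - j < m)) [map _ _]zt eT staircase_columns // count_map.
rewrite -[RHS](minn_idPl (ltnW jd)) -count_lt_iota; apply: eq_in_count => i.
by rewrite mem_iota /=; move: jd dn; clear; lia.
Qed.

Let entries_count C : (forall j, j < d -> sorted leq (C j) /\ size (C j) = n - j) ->
  (forall b, in_diagram mu b -> entry T b <= nth 0 (C b.1) b.2) <->
  (forall j, j < d -> forall y,
     count (fun v => y <= v) (nth [::] t j) <= count (fun v => y <= v) (C j)).
Proof.
move=> hC.
have cmp j : j < d -> (forall i, i < size (nth [::] t j) -> nth 0 (nth [::] t j) i <= nth 0 (C j) i) <->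
   (forall y, count (fun v => y <= v) (nth [::] t j) <= count (fun v => y <= v) (C j)).
  move=> jd; have [sC zC] := hC j jd; apply: entries_le_count => //.
    by apply: sub_sorted (col_t jd) => u v /ltnW.
  by rewrite size_nth_t.
have ent j i : j < d -> in_diagram mu (j, i) = (i < size (nth [::] t j)) /\
    (in_diagram mu (j, i) -> nth 0 (nth [::] t j) i = entry T (j, i)).
  move=> jd; have jh : j < head 0 (shape T) by rewrite headT.
  have [h1 h2] := column_entry pT jh; rewrite nth_t // -eT h1.
  by split; [rewrite nth_column_lengths | apply: h2].
split=> [h j jd|h [j i] db].
  apply/(cmp j jd) => i lt; have [e1 e2] := ent j i jd.
  by rewrite e2 ?e1 //; apply: (h (j, i)); rewrite e1.
have jd : j < d by have := diagram_head (staircase_part n d) db; rewrite -/mu -eT headT.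
have [e1 e2] := ent j i jd; rewrite -e2 //; apply: (proj2 (cmp j jd)); first exact: h.
by rewrite -e1.
Qed.

Let below_keyP : tableau_le T (key mu w) <->
  forall j, j < d -> below_key x (nth [::] t j).
Proof.
pose C j := sort leq (take (nth 0 (column_lengths mu) j) x).
have hC j : j < d -> sorted leq (C j) /\ size (C j) = n - j.
  move=> jd; split; first by apply: sort_sorted; apply: leq_total.
  by rewrite size_sort -eT nth_len // size_takel // one_rowed_size leq_subr.
have eC j y : j < d -> count (fun v => y <= v) (C j) =
    count (fun v => y <= v) (take (size (nth [::] t j)) x).
  move=> jd; rewrite size_nth_t // -(nth_len jd) eT.
  by apply/seq.permP; rewrite perm_sort.
have hle : tableau_le T (key mu w) <->
    (forall b, in_diagram mu b -> entry T b <= nth 0 (C b.1) b.2).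
  split=> h b.
    by move=> db; have := h b; rewrite eT key_of_columns entry_of_columns // => /(_ db).
  by rewrite eT => db; rewrite key_of_columns entry_of_columns //; apply: h.
split=> [/hle/(entries_count hC) h j jd|h].
  split; first by rewrite size_nth_t // one_rowed_size leq_subr.
  by move=> y; rewrite -eC //; apply: h.
apply/hle/(entries_count hC) => j jd y; rewrite eC //; exact: (proj2 (h j jd) y).
Qed.

Let drop_t j : j < d -> drop j t = nth [::] t j :: drop j.+1 t.
Proof. by move=> jd; rewrite (drop_nth [::]) ?size_t. Qed.

Let st : straight t. Proof. by have [_ ? _] := tableau_columns vT'. Qed.

Let right_column j S : j < d -> frank_witness n T (n - j) S ->
  let C := rightmost_column S in
  [/\ col C, size C = n - j & forall y,
  (exists2 p, chain y p (word (drop j t)) & size p = count (fun v => y <= v) C) /\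
  (forall p, chain y p (word (drop j t)) -> size p <= count (fun v => y <= v) C)].
Proof.
move=> jd fw C; have k0 : 0 < n - j by move: jd dn; clear; lia.
have [cC zC zB [Q k]] := frank_witness_last vT' fw k0; rewrite -/t count_t // in zB k.
split=> //; apply: last_column_count cC _ k _; first exact: straight_drop.
by rewrite zB zC.
Qed.

Let chain_own j y : j < d -> exists2 p, chain y p (word (drop j t)) &
  size p = count (fun v => y <= v) (nth [::] t j).
Proof.
move=> jd; exists (filter (fun v => y <= v) (rev (nth [::] t j))).
  rewrite drop_t // word_cons; apply/and3P; split.
  - exact: subseq_trans (filter_subseq _ _) (prefix_subseq _ _).
  - by apply: sorted_filter gtn_trans _ _ _; rewrite rev_sorted col_t.
  - exact: filter_all.
by rewrite size_filter count_rev.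
Qed.

Let witness j : j < d -> exists S, frank_witness n T (n - j) S.
Proof. by move=> jd; rewrite -(size_nth_t jd); apply: frank_witness_exists; rewrite ?size_t. Qed.

Let len_cl : size (column_lengths (shape T)) = d.
Proof. by rewrite size_map size_iota headT. Qed.

(** The entries >= y of a column of T form a chain, so T is below its right key. *)
Lemma right_key_le K : is_right_key n T K -> tableau_le K (key mu w) ->
  tableau_le T (key mu w).
Proof.
move=> [eK hK] KY b bT; have KT : shape K = mu by rewrite eK.
apply: leq_trans (KY b _); last by rewrite eK.
rewrite eT in bT; case: b bT => j i bT.
have jd : j < d by have := diagram_head (staircase_part n d) bT; rewrite -/mu -eT headT.
have jh : j < head 0 (shape K) by rewrite eK headT.
have pK : is_partition (shape K) by rewrite eK.
have [_ h2] := column_entry pK jh; rewrite -h2 ?KT //.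
have := hK j; rewrite len_cl nth_len // => /(_ jd) [[S fw] /(_ S fw) <-].
have [cC zC hC] := right_column jd fw.
have [e1 e2] := column_entry pT (eq_ind_r (fun m => j < m) jd headT).
rewrite -e2 ?eT // -nth_t //.
apply: (proj2 (entries_le_count _ _ _)).
- by apply: sub_sorted (col_t jd) => u v /ltnW.
- by apply: sub_sorted cC => u v /ltnW.
- by rewrite size_nth_t.
- by move=> y; have [p cp <-] := chain_own y jd; have [_ /(_ p cp)] := hC y.
by rewrite nth_t // e1 nth_column_lengths ?headT // eT.
Qed.

Lemma finite_choice (P : nat -> seq nat -> Prop) :
  (forall j, j < d -> exists C, P j C) -> exists C, forall j, j < d -> P j (C j).
Proof.
elim: d => [|m IH] h; first by exists (fun=> [::]).
have [C hC] := IH (fun j jm => h j (ltnW jm)); have [c hc] := h m (leqnn _).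
exists (fun j => if j == m then c else C j) => j; rewrite ltnS leq_eqVlt.
case: eqP => [-> _ //|_] /=; exact: hC.
Qed.

(** The counting formula for the last column shows at once that the right key is
    well defined and, through the bound on chains, that it is below the key of w. *)
Lemma right_key_exists : avoids_312 w -> tableau_le T (key mu w) ->
  exists2 K, is_right_key n T K & tableau_le K (key mu w).
Proof.
move=> av TY.
pose P j C := [/\ col C, size C = n - j & forall y,
  (exists2 p, chain y p (word (drop j t)) & size p = count (fun v => y <= v) C) /\
  (forall p, chain y p (word (drop j t)) -> size p <= count (fun v => y <= v) C)].
have [C hC] : exists C, forall j, j < d -> P j (C j).
  apply: finite_choice => j jd; have [S fw] := witness jd.
  by exists (rightmost_column S); apply: right_column.
have cK j : j < d -> column (skew_of (of_columns mu C)) j = C j.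
  move=> jd; apply: column_of_columns; first exact: staircase_part.
    by rewrite -eT headT.
  by have [_ -> _] := hC j jd; rewrite -eT nth_len.
exists (of_columns mu C).
  split; first by rewrite shape_of_columns eT.
  move=> j; rewrite len_cl => jd k; rewrite /k nth_len //.
  split; first exact: witness.
  move=> S fw; rewrite cK //; have [c1 z1 h1] := right_column jd fw.
  have [c2 z2 h2] := hC j jd; apply: col_count_eq => // y.
  have [[p1 cp1 e1] g1] := h1 y; have [[p2 cp2 e2] g2] := h2 y.
  by apply/eqP; rewrite eqn_leq -{1}e1 -{2}e2 g1 ?g2.
move=> b; rewrite shape_of_columns => db; rewrite key_of_columns !entry_of_columns //.
case: b db => j i db /=.
have jd : j < d by have := diagram_head (staircase_part n d) db; rewrite -/mu -eT headT.
have [cC zC gC] := hC j jd.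
apply: (proj2 (entries_le_count _ _ _)).
- by apply: sub_sorted cC => u v /ltnW.
- by apply: sort_sorted; apply: leq_total.
- by rewrite size_sort -eT nth_len // size_takel // one_rowed_size leq_subr.
- move=> y; rewrite (_ : count _ (sort _ _) = count (fun v => y <= v) (take (n - j) x)); last first.
    by rewrite -eT nth_len //; apply/seq.permP; rewrite perm_sort.
  have [[p cp <-] _] := gC y; rewrite -(size_nth_t jd).
  rewrite drop_t // in cp; apply: chain_le_key cp.
  + exact: one_rowed_uniq.
  + exact: one_rowed_mem.
  + exact: one_rowed_avoids.
  + by rewrite -drop_t //; apply: straight_drop.
  + move=> c; rewrite -drop_t // => /mem_drop /(nthP [::]) [i']; rewrite size_t => i'd <-.
    by apply: (proj1 below_keyP TY).
by rewrite zC -(nth_len jd) eT nth_column_lengths ?staircase_part // -/mu -eT headT.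
Qed.

End Staircase.

(** * Convex polytopes *)

Import GRing.Theory Num.Theory.
Local Open Scope ring_scope.

Section Polytope.
Variables (R : realType) (N : nat).
Implicit Types P Q : 'cV[int]_N -> Prop.

Lemma polytope_ext P Q : (forall x, P x <-> Q x) -> convex_polytope R P -> convex_polytope R Q.
Proof.
move=> PQ [m m0 [A [b h]]]; exists m => //; exists A, b => x.
by apply: iff_trans (h x); apply: iff_sym.
Qed.

Lemma polytope_le (a : 'rV[int]_N) (c : int) : convex_polytope R (fun x => (a *m x) 0 0 <= c).
Proof.
exists 1%N => //; exists (map_mx intr a), (const_mx c%:~R) => x.
have e : ((map_mx intr (a *m x) : 'M[R]_1) 0 0 <=
    (const_mx c%:~R : 'cV[R]_1) 0 0) = ((a *m x) 0 0 <= c).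
  by rewrite [map_mx _ _ _ _]mxE [const_mx _ _ _]mxE ler_int.
by rewrite -map_mxM -e; split=> [h q|/(_ 0)//]; rewrite (ord1 q).
Qed.

Lemma polytope_true : convex_polytope R (fun _ : 'cV[int]_N => True).
Proof.
apply: polytope_ext (polytope_le 0 0) => x; split=> // _.
by rewrite mul0mx mxE.
Qed.

Lemma polytope_and P Q : convex_polytope R P -> convex_polytope R Q ->
  convex_polytope R (fun x => P x /\ Q x).
Proof.
move=> [m m0 [A [b hA]]] [k k0 [B [c hB]]]; exists (m + k)%N; first by rewrite addn_gt0 m0.
exists (col_mx A B), (col_mx b c) => x; rewrite mul_col_mx; split.
  move=> [/hA h1 /hB h2] q; case: (splitP q) => i e.
    by rewrite (_ : q = lshift k i) ?col_mxEu //; apply: val_inj.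
  by rewrite (_ : q = rshift m i) ?col_mxEd //; apply: val_inj.
move=> h; split; [apply/hA => q | apply/hB => q].
  by have := h (lshift k q); rewrite !col_mxEu.
by have := h (rshift m q); rewrite !col_mxEd.
Qed.

Lemma polytope_if (e : bool) P : convex_polytope R P -> convex_polytope R (fun x => e -> P x).
Proof.
case: e => h; first by apply: polytope_ext h => x; split=> // /(_ isT).
by apply: polytope_ext polytope_true.
Qed.

Lemma polytope_all (I : eqType) (s : seq I) (F : I -> 'cV[int]_N -> Prop) :
  (forall i, convex_polytope R (F i)) ->
  convex_polytope R (fun x => forall i, i \in s -> F i x).
Proof.
move=> h; elim: s => [|i s IH]; first by apply: polytope_ext polytope_true.
apply: polytope_ext (polytope_and (h i) IH) => x; split=> [[h1 h2] j|hs].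
  by rewrite inE => /orP[/eqP->//|]; apply: h2.
by split=> [|j js]; apply: hs; rewrite inE ?eqxx // js orbT.
Qed.

End Polytope.

Definition coordinate (N k : nat) : 'rV[int]_N := \row_q ((q : nat) == k)%:R.

Lemma coordinateE (N : nat) (x : 'cV[int]_N) (p : 'I_N) : (coordinate N p *m x) 0 0 = x p 0.
Proof.
rewrite mxE (bigD1 p) //= mxE eqxx mul1r big1 ?addr0 // => q qp.
by rewrite mxE val_eqE (negPf qp) mul0r.
Qed.

Lemma nth_flatten_index (T : seq (seq nat)) b : in_diagram (shape T) b ->
  nth 0%N (flatten T) (flatten_index (shape T) b.2 b.1) = entry T b.
Proof.
by move=> db; rewrite nth_flatten flatten_indexKl // flatten_indexKr.
Qed.

(** One inequality for each bound on an entry and for each pair of adjacent boxes.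
    Conversely, the inequalities make the coordinates positive, so that they can be
    read as the entries of a tableau. *)
Lemma tableaux_below_polytope (R : realType) n mu (U : seq (seq nat)) : is_partition mu ->
  convex_polytope R (@tableau_points (sumn mu)
     (fun T => is_tableau n mu T /\ tableau_le T U)).
Proof.
move=> pmu; pose N := sumn mu.
pose pos (b : box) := flatten_index mu b.2 b.1.
pose at_ (x : 'cV[int]_N) b := (coordinate N (pos b) *m x) 0 0.
pose boxes := [seq (j, i) | i <- iota 0 (size mu), j <- iota 0 (nth 0%N mu i)].
have boxesP b : (b \in boxes) = in_diagram mu b.
  apply/allpairsPdep/idP => [[i [j [_ + ->]]]|db].
    by rewrite mem_iota.
  exists b.2, b.1; rewrite !mem_iota /=; split=> //; last by case: (b).
  exact: diagram_size.
have leP (b b' : box) c : convex_polytope R (fun x => at_ x b <= at_ x b' + c).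
  apply: polytope_ext (polytope_le R (coordinate N (pos b) - coordinate N (pos b')) c) => x.
  by rewrite mulmxBl mxE [X in _ + X]mxE lerBlDl.
have geP (b : box) c : convex_polytope R (fun x => c <= at_ x b).
  apply: polytope_ext (polytope_le R (- coordinate N (pos b)) (- c)) => x.
  by rewrite mulNmx mxE lerN2.
have upP (b : box) c : convex_polytope R (fun x => at_ x b <= c).
  exact: polytope_le.
apply: polytope_ext (@polytope_all R N _ boxes (fun b x =>
  [/\ 1 <= at_ x b, at_ x b <= n%:Z & at_ x b <= (entry U b)%:Z] /\
  (in_diagram mu (right_of b) -> at_ x b <= at_ x (right_of b) + 0) /\
  (in_diagram mu (below b) -> at_ x b <= at_ x (below b) + -1)) _); last first.
  move=> b; apply: polytope_and; last first.
    by apply: polytope_and; apply: polytope_if.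
  apply: (@polytope_ext _ _ (fun x => 1 <= at_ x b /\ (at_ x b <= n%:Z /\ at_ x b <= (entry U b)%:Z))).
    by move=> x; split=> [[? []]|[]].
  by do 2?apply: polytope_and.
have at_entry (x : 'cV[int]_N) T : shape T = mu ->
    (forall p : 'I_N, x p 0 = Posz (nth 0%N (flatten T) p)) ->
    forall b, in_diagram mu b -> at_ x b = (entry T b)%:Z.
  move=> eT h b db; have lt : (pos b < N)%N by apply: flatten_indexP.
  rewrite /at_ (coordinateE x (Ordinal lt)) h /= /pos -eT nth_flatten_index // eT //.
have dmono b b' := @diagram_mono mu b b' pmu.
move=> x; split=> [h|[T [[eT vT] TU] hx] b]; last first.
  have [[_ _ _] [rg row colm]] := vT.
  have e := at_entry x T eT hx.
  have sk b' : in_skew (skew_of T) b' = in_diagram mu b' by rewrite in_skew_of eT.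
  rewrite boxesP => db; have := rg b; rewrite sk => /(_ db) /andP[r1 r2].
  have := TU b; rewrite eT => /(_ db) r3.
  rewrite (e b db); split; first by rewrite !lez_nat.
  split=> db'; rewrite e //.
    by have := row b; rewrite !sk => /(_ db db'); rewrite addr0 lez_nat.
  by have := colm b; rewrite !sk => /(_ db db'); rewrite /=; lia.
pose T := reshape mu [seq absz (x p 0) | p : 'I_N <- enum 'I_N].
have eT : shape T = mu by apply: reshapeKl; rewrite size_map size_enum_ord.
have fT : flatten T = [seq absz (x p 0) | p : 'I_N <- enum 'I_N].
  by apply: reshapeKr; rewrite size_map size_enum_ord.
have hx (p : 'I_N) : x p 0 = Posz (nth 0%N (flatten T) p).
  rewrite fT (nth_map p) ?size_enum_ord // nth_ord_enum.
  pose b := (reshape_offset mu p, reshape_index mu p).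
  have db : in_diagram mu b by apply: reshape_offsetP.
  have pb : pos b = p by apply: reshape_indexK.
  have := h b; rewrite boxesP => /(_ db) [[h1 _ _] _].
  by move: h1; rewrite /at_ pb coordinateE; lia.
have e := at_entry x T eT hx.
have sk b' : in_skew (skew_of T) b' = in_diagram mu b' by rewrite in_skew_of eT.
have h' b (db : in_diagram mu b) := h b (eq_ind_r is_true db (boxesP b)).
exists T => //; split; first split=> //.
  split; split=> //.
  - by rewrite /= eT.
  - by move=> b; rewrite /in_diagram /= nth_nil.
  - move=> b; rewrite sk => db; have [[]] := h' b db; rewrite (e b db) /= !lez_nat.
    by move=> -> ->.
  - move=> b; rewrite !sk => db db'; have [_ [+ _]] := h' b db.
    by move/(_ db'); rewrite !e // addr0 lez_nat.
  - move=> b; rewrite !sk => db db'; have [_ [_ +]] := h' b db.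
    by move/(_ db'); rewrite !e //=; lia.
move=> b; rewrite eT => db; have [[_ _]] := h' b db.
by rewrite (e b db) lez_nat.
Qed.

Local Close Scope ring_scope.

Theorem corollary3p7p2 (R : realType) (n d : nat) (w : 'S_n)
  (hn : 1 <= n) (hd : 1 <= d <= n) (hw : avoids_312 w) :
  convex_polytope R
    (@tableau_points (sumn (staircase n d)) (demazure (staircase n d) w)).
Proof.
apply: polytope_ext (tableaux_below_polytope R n (key (staircase n d) w) (staircase_part n d)) => x.
split=> -[T [vT hT] hx]; exists T => //; split=> //.
  exact: right_key_exists.
by case: hT => K; apply: right_key_le.
Qed.
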